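(* Let $1<g\in\mathbb{N}$ and let $\mathbf{T}=\bigcup_{i\ge1}T_i$ be a $g$-discrete self-similar fractal with generator $G$. Then the full grid graph of $\mathbf{T}$ is a tree if and only if (a) the full grid graph of $G$ is a tree, and (b) $nhb_G=nvb_G=1$.
   Context: For $g\in\mathbb{N}$ write $\mathbb{N}_g=\{0,\dots,g-1\}$; for $A,B\subseteq\mathbb{N}^2$ and $k\in\mathbb{N}$, $A+kB=\{\vec m+k\vec n : \vec m\in A,\vec n\in B\}$. Let $1<g\in\mathbb{N}$. A set $\mathbf{X}\subset\mathbb{N}^2$ is a $g$-discrete self-similar fractal if there is a set $G$ with $\{(0,0)\}\subsetneq G\subsetneq\mathbb{N}_g^2$ having at least one point in every row and every column of $\mathbb{N}_g^2$ such that $\mathbf{X}=\bigcup_{i\ge1}X_i$, where $X_1=G$ and $X_{i+1}=X_i+g^iG$; $G$ is the generator. The full grid graph of $V\subseteq\mathbb{Z}^2$ has vertex set $V$ and an edge between $\vec x,\vec y$ iff $\|\vec x-\vec y\|=1$; ''tree'' means this graph is connected and acyclic. For a finite $S\subseteq\mathbb{Z}^2$ let $l_S=\min_{(x,y)\in S}x$, $r_S=\max_{(x,y)\in S}x$, $b_S=\min_{(x,y)\in S}y$, $t_S=\max_{(x,y)\in S}y$. An h-bridge of $S$ is a subset of $S$ of the form $\{(l_S,y),(r_S,y)\}$ (both points in $S$); a v-bridge of $S$ is a subset of $S$ of the form $\{(x,b_S),(x,t_S)\}$. $nhb_S$ and $nvb_S$ denote the number of h-bridges and v-bridges of $S$.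 *)

(* Defs.v *)
From mathcomp Require Import all_boot.
Set Implicit Arguments. Unset Strict Implicit. Unset Printing Implicit Defensive.

Definition pt := (nat * nat)%type.

Definition emb (g : nat) (p : 'I_g * 'I_g) : pt := (val p.1, val p.2).

Definition setN2 (g : nat) (G : {set 'I_g * 'I_g}) (v : pt) : Prop :=
  exists2 p, p \in G & emb p = v.

Definition generator (g : nat) (G : {set 'I_g * 'I_g}) : Prop :=
  [/\ setN2 G (0, 0),
      (exists2 p, p \in G & emb p != (0, 0)),
      G != setT,
      (forall y : 'I_g, exists x : 'I_g, (x, y) \in G) &
      (forall x : 'I_g, exists y : 'I_g, (x, y) \in G)].

(* Xs g G i = X_{i+1} of the paper:
   X_1 = G, X_{i+1} = X_i + g^i G. *)
Fixpoint Xs (g : nat) (G : {set 'I_g * 'I_g}) (i : nat) : pt -> Prop :=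
  match i with
  | 0 => setN2 G
  | i'.+1 => fun v => exists m n, [/\ Xs G i' m, setN2 G n &
                 v = (m.1 + g ^ i'.+1 * n.1, m.2 + g ^ i'.+1 * n.2)]
  end.

Definition fractal (g : nat) (G : {set 'I_g * 'I_g}) (v : pt) : Prop :=
  exists i, Xs G i v.

Definition adj (a b : pt) : bool :=
  ((a.1 == b.1) && ((a.2 == b.2.+1) || (b.2 == a.2.+1))) ||
  ((a.2 == b.2) && ((a.1 == b.1.+1) || (b.1 == a.1.+1))).

Definition grid_connected (V : pt -> Prop) : Prop :=
  forall u v, V u -> V v ->
    exists p : seq pt, [/\ path adj u p, last u p = v & forall w, w \in p -> V w].

Definition grid_acyclic (V : pt -> Prop) : Prop :=
  ~ exists c : seq pt,
      [/\ 3 <= size c, uniq c, cycle adj c & forall w, w \in c -> V w].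

Definition grid_tree (V : pt -> Prop) : Prop := grid_connected V /\ grid_acyclic V.

Definition lS g (S : {set 'I_g * 'I_g}) : nat := \big[minn/g]_(p in S) val p.1.
Definition rS g (S : {set 'I_g * 'I_g}) : nat := \max_(p in S) val p.1.
Definition bS g (S : {set 'I_g * 'I_g}) : nat := \big[minn/g]_(p in S) val p.2.
Definition tS g (S : {set 'I_g * 'I_g}) : nat := \max_(p in S) val p.2.

Definition nhb g (S : {set 'I_g * 'I_g}) : nat :=
  #|[set y : 'I_g | [exists p in S, (val p.1 == lS S) && (p.2 == y)] &&
                    [exists p in S, (val p.1 == rS S) && (p.2 == y)]]|.

Definition nvb g (S : {set 'I_g * 'I_g}) : nat :=
  #|[set x : 'I_g | [exists p in S, (p.1 == x) && (val p.2 == bS S)] &&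
                    [exists p in S, (p.1 == x) && (val p.2 == tS S)]]|.

(* Main.v *)
(* A point of the fractal X is a block q in X together with an offset p in the
   generator G, so X is a copy of itself with every point blown up to a copy of G,
   adjacent blocks being joined by one edge per bridge of the given direction.

   If G is a tree with one bridge in each direction, this blow-up preserves
   connectedness, and an edge between two blocks lying on a cycle would project
   to an edge lying on a cycle of the (smaller) block graph.

   Conversely let X be a tree. Once G is known to be connected, two parallel
   bridges would close a cycle through two adjacent blocks; so suppose that G is
   disconnected. If every point of X had a neighbour in direction s (left or right)
   or t (up or down), a border column and a border row of G would be full and every
   point of G could walk to their corner; hence some block lacks both neighbours,
   and each component of G must leave it through one of the two opposite sides.
   Therefore each component of G has bridge points on both the left and right
   sides, or on both the top and bottom sides; by planarity the same alternative,
   say left-right, holds for all of them, and there are at least two horizontal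
   bridges. Now consider a maximal horizontal run of blocks. If its blow-up had two
   components, they would all go from one end to the other, so by planarity at most
   one would touch the top and at most one the bottom, and, X being acyclic, nothing
   outside of the run could connect them. Hence the blow-up of a segment having the
   length of a maximal run is connected, and the two bridges close a cycle as soon
   as two such segments follow each other in X. This happens: along a row of G
   which carries a bridge, either inside the row if it is full, or by gluing the
   final run of the row to its initial run in the next block. *)
Require Import Defs.
From mathcomp Require Import all_boot zify.
From Stdlib Require Import Relations Classical.
Set Implicit Arguments. Unset Strict Implicit. Unset Printing Implicit Defensive.

(** * Connectedness and cut edges in grid graphs *)

Definition edge (V : pt -> Prop) (u v : pt) : Prop := [/\ V u, V v & adj u v].

(* Reflexive also outside of [V]. *)
Definition conn (V : pt -> Prop) : pt -> pt -> Prop := clos_refl_trans pt (edge V).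

Definition edge_but (u v : pt) (V : pt -> Prop) (a b : pt) : Prop :=
  [/\ edge V a b, (a, b) <> (u, v) & (a, b) <> (v, u)].

(** Acyclicity in terms of walks: no edge can be bypassed. A bypass may be glued from arbitrary
    walks, with no care for repeated vertices. *)
Definition edges_cut (V : pt -> Prop) : Prop :=
  forall u v, edge V u v -> ~ clos_refl_trans pt (edge_but u v V) v u.

Definition connected (V : pt -> Prop) : Prop :=
  forall u v, V u -> V v -> conn V u v.

Lemma adj_sym (u v : pt) : adj u v -> adj v u.
Proof. by case: u v => [a b] [c d]; rewrite /adj /=; lia. Qed.

Lemma edge_sym V u v : edge V u v -> edge V v u.
Proof. by case=> *; split=> //; apply: adj_sym. Qed.

Lemma rt_mono (T S : Type) (R : T -> T -> Prop) (R' : S -> S -> Prop)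
    (f : T -> S) u v :
  (forall a b, R a b -> clos_refl_trans S R' (f a) (f b)) ->
  clos_refl_trans T R u v -> clos_refl_trans S R' (f u) (f v).
Proof.
move=> sRR'; elim=> [a b /sRR'//|a|a b c _ IH1 _ IH2]; first exact: rt_refl.
exact: rt_trans IH1 IH2.
Qed.

Lemma rt_sym (T : Type) (R : T -> T -> Prop) u v :
  (forall a b, R a b -> R b a) ->
  clos_refl_trans T R u v -> clos_refl_trans T R v u.
Proof.
move=> symR; elim=> [a b /symR|a|a b c _ IH1 _ IH2]; first exact: rt_step.
  exact: rt_refl.
exact: rt_trans IH2 IH1.
Qed.

Lemma rt_closed (T : Type) (R : T -> T -> Prop) (U : T -> Prop) u v :
  (forall a b, U a -> R a b -> U b) -> U u -> clos_refl_trans T R u v -> U v.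
Proof.
move=> closedU + uv; elim: uv => [a b ab Ua|//|a b c _ IH1 _ IH2 /IH1 /IH2 //].
exact: closedU ab.
Qed.

Lemma conn_sym V u v : conn V u v -> conn V v u.
Proof. exact/rt_sym/edge_sym. Qed.

Lemma conn_refl V u : conn V u u. Proof. exact: rt_refl. Qed.

Lemma conn_trans V v u w : conn V u v -> conn V v w -> conn V u w.
Proof. exact: rt_trans. Qed.

Lemma conn_mem V u v : conn V u v -> V u -> V v.
Proof. by move=> uv Vu; apply: rt_closed Vu uv => a b _ []. Qed.

Lemma conn_edge V u v : V u -> V v -> adj u v -> conn V u v.
Proof. by move=> *; apply: rt_step; split. Qed.

Lemma path_conn V u p :
  path adj u p -> V u -> (forall w, w \in p -> V w) -> conn V u (last u p).
Proof.
elim: p u => [|w p IH] u /=; first by move=> *; apply: conn_refl.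
case/andP=> uw pp Vu Vp; have Vw : V w by apply: Vp; rewrite inE eqxx.
apply: conn_trans (conn_edge Vu Vw uw) (IH w pp Vw _) => x px.
by apply: Vp; rewrite inE px orbT.
Qed.

Lemma rt_path (e : rel pt) (R : pt -> pt -> Prop) (V : pt -> Prop) u v :
  (forall a b, R a b -> e a b /\ V b) -> clos_refl_trans pt R u v ->
  exists p, [/\ path e u p, last u p = v & forall w, w \in p -> V w].
Proof.
move=> ReV uv; elim/clos_refl_trans_ind_left: v / uv => [|v w _ [p [pp <- Vp]]].
  by exists [::].
case/ReV=> lw Vw; exists (rcons p w); split; rewrite ?rcons_path ?pp ?last_rcons //.
by move=> x; rewrite mem_rcons inE => /orP[/eqP->|/Vp].
Qed.

Lemma conn_path V u v : conn V u v ->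
  exists p, [/\ path adj u p, last u p = v & forall w, w \in p -> V w].
Proof. by apply: rt_path => a b []. Qed.

Lemma grid_connectedP V : grid_connected V <-> connected V.
Proof.
split=> cV u v Vu Vv; last exact/conn_path/cV.
by have [p [pp <- Vp]] := cV u v Vu Vv; apply: path_conn.
Qed.

Lemma adjxx u : adj u u = false.
Proof. by case: u => a b; rewrite /adj /=; lia. Qed.

Lemma acyclic_edges_cut V : grid_acyclic V -> edges_cut V.
Proof.
move=> acV u v [Vu Vv uv] vu; apply: acV.
pose e a b := [&& adj a b, (a, b) != (u, v) & (a, b) != (v, u)].
have [|p [pp lp Vp]] := @rt_path e _ V v u _ vu.
  by move=> a b [[_ Vb ab] /eqP ? /eqP ?]; split=> //; apply/and3P; split.
move: lp; case: (shortenP pp) => q eq uq sqp lq.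
exists (v :: q); split=> //.
(* A simple path with at most one edge would be a loop or the removed edge itself. *)
- case: q eq lq {uq sqp} => [|a [|b q]] //=.
    by move=> _ vu'; rewrite vu' adjxx in uv.
  by rewrite andbT => eva au; move: eva; rewrite au /e eqxx !andbF.
- rewrite /= rcons_path lq uv andbT; apply: sub_path eq => a b; by case/andP.
- by move=> w; rewrite inE => /orP[/eqP->//|/sqp/Vp].
Qed.

Lemma cycle_edge_but V c x :
  3 <= size c -> uniq c -> cycle adj c -> (forall w, w \in c -> V w) ->
  x \in c -> edge V x (next c x) /\
    clos_refl_trans pt (edge_but x (next c x) V) (next c x) x.
Proof.
move=> sc uc cc Vc cx; have nx := next_cycle cc cx.
have edx : edge V x (next c x) by split=> //; apply: Vc; rewrite ?mem_next.
split=> //.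
have [i s rc] := rot_to cx.
have Vs w : w \in x :: s -> V w by rewrite -rc mem_rot => /Vc.
have us : uniq (x :: s) by rewrite -rc rot_uniq.
have cs : cycle adj (x :: s) by rewrite -rc rot_cycle.
have ss : 3 <= size (x :: s) by rewrite -rc size_rot.
have -> : next c x = next (x :: s) x by rewrite -rc next_rot.
case: s rc Vs us cs ss => [|y [|z s]] //= _ Vs us cs _; rewrite eqxx.
case/and3P: us => xs ys /andP[zs us]; case/andP: cs => xy /andP[yz pzs].
have Vx : V x by apply: Vs; rewrite inE eqxx.
have Vy : V y by apply: Vs; rewrite !inE eqxx orbT.
set E := edge_but x y V.
(* A walk that avoids [x] and [y] until it ends at [x] never uses the edge between them. *)
suff main l q : q \notin [:: x; y] -> V q -> path adj q (rcons l x) ->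
    (forall w, w \in l -> V w /\ w \notin [:: x; y]) -> clos_refl_trans pt E q x.
  have zn : z \notin [:: x; y].
    apply/negP; rewrite !inE => /orP[/eqP zx|/eqP zy].
      by move: xs; rewrite zx !inE eqxx orbT.
    by move: ys; rewrite zy !inE eqxx.
  have Vz : V z by apply: Vs; rewrite !inE eqxx !orbT.
  apply: (rt_trans _ _ _ z).
    apply: rt_step; split=> //.
    - by move=> [yx _]; rewrite yx adjxx in xy.
    - by move=> [zx]; rewrite zx !inE eqxx in zn.
  apply: (main s) => // w ws; split; first by apply: Vs; rewrite !inE ws !orbT.
  apply/negP; rewrite !inE => /orP[/eqP wx|/eqP wy].
    by move: xs; rewrite -wx !inE ws !orbT.
  by move: ys; rewrite -wy !inE ws !orbT.
elim: l q => [|w l IH] q qn Vq /=.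
  rewrite andbT => qx _; apply: rt_step; split=> //.
  - by move=> [qx']; rewrite qx' adjxx in qx.
  - by move=> [qy]; rewrite qy !inE eqxx orbT in qn.
case/andP=> qw pl Vl; have [Vw wn] := Vl w (mem_head _ _).
apply: (rt_trans _ _ _ w); last first.
  by apply: IH => // w' w'l; apply: Vl; rewrite inE w'l orbT.
apply: rt_step; split=> //; move=> [qe _]; move: qn; rewrite qe !inE eqxx //.
by rewrite orbT.
Qed.

(** The first link is bypassed through [B], back along the second link and through [A]; as [A] and
    [B] are disjoint, no walk inside one of them uses a link. *)
Lemma two_links V (A B : pt -> Prop) a1 a2 b1 b2 :
  edges_cut V -> (forall v, A v -> V v) -> (forall v, B v -> V v) ->
  (forall v, A v -> ~ B v) -> A a1 -> A a2 -> B b1 -> B b2 ->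
  conn A a1 a2 -> conn B b1 b2 -> adj a1 b1 -> adj a2 b2 ->
  (a1, b1) <> (a2, b2) -> False.
Proof.
move=> brV sA sB dAB A1 A2 B1 B2 a12 b12 adj1 adj2 ne.
have e1 : edge V a1 b1 by split; auto.
apply: (brV _ _ e1); apply: (rt_trans _ _ _ b2).
  apply: (rt_mono (f := id)) b12 => a b [Ba Bb ab].
  apply: rt_step; split; first by split; auto.
    by move=> [aa _]; apply: (dAB a1 A1); rewrite -aa.
  by move=> [_ ba]; apply: (dAB a1 A1); rewrite -ba.
apply: (rt_trans _ _ _ a2).
  apply: rt_step; split; first by split; auto; apply: adj_sym.
    by move=> [ba _]; apply: (dAB a1 A1); rewrite -ba.
  by move=> [bb aa]; apply: ne; rewrite bb aa.
apply: (rt_mono (f := id)) (conn_sym a12) => a b [Aa Ab ab].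
apply: rt_step; split; first by split; auto.
  by move=> [_ bb]; apply: (dAB b Ab); rewrite bb.
by move=> [ba _]; apply: (dAB a Aa); rewrite ba.
Qed.
(** * Noncrossing paths *)

Inductive dir := dL | dR | dB | dT.

Definition opp (d : dir) : dir :=
  match d with dL => dR | dR => dL | dB => dT | dT => dB end.

Definition step (d : dir) (u v : pt) : Prop :=
  match d with
  | dL => u = (v.1.+1, v.2)
  | dR => v = (u.1.+1, u.2)
  | dB => u = (v.1, v.2.+1)
  | dT => v = (u.1, u.2.+1)
  end.

Lemma adjP u v : adj u v <-> exists d, step d u v.
Proof.
case: u v => [a b] [c d]; rewrite /adj /=; split.
  case/orP=> /andP[/eqP-> /orP[]/eqP->]; by [exists dB | exists dT | exists dL | exists dR].
by case=> -[] /= [-> ->]; rewrite !eqxx ?orbT.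
Qed.

Lemma step_opp d u v : step d u v -> step (opp d) v u.
Proof. by case: d. Qed.

Lemma step_adj d u v : step d u v -> adj u v.
Proof. by move=> uv; apply/adjP; exists d. Qed.

(** The edge meets the leftward ray issued from [(x, y + 1/2)], strictly left of its origin. The
    half-integral height keeps the ray off the vertices. *)
Definition crosses (x y : nat) (a b : pt) : bool :=
  [&& a.1 == b.1, a.1 < x & (a.2 == y) && (b.2 == y.+1) || (b.2 == y) && (a.2 == y.+1)].

Fixpoint crossings (x y : nat) (a : pt) (p : seq pt) : bool :=
  if p is b :: p' then crosses x y a b (+) crossings x y b p' else false.

Lemma crossings_left x y a p :
  (forall w, w \in a :: p -> x <= w.1) -> crossings x y a p = false.
Proof.
elim: p a => //= b p IH a xp; rewrite IH; last first.
  by move=> w wp; apply: xp; rewrite inE wp orbT.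
by have := xp a (mem_head _ _); rewrite /crosses; lia.
Qed.

(** An edge between rows [y] and [y + 1] is missed by the ray only at abscissa [x], where it would
    contain [(x, y)]. So the parity tells whether the ends are on different sides of height
    [y + 1/2]. *)
Lemma crossings_right x y a p :
  path adj a p -> (forall w, w \in a :: p -> w.1 <= x) -> (x, y) \notin a :: p ->
  crossings x y a p = (a.2 <= y) (+) ((last a p).2 <= y).
Proof.
elim: p a => [|b p IH] a /=; first by rewrite addbb.
case/andP=> ab pp px; rewrite inE negb_or => /andP[na nb]; rewrite IH //; last first.
  by move=> w wp; apply: px; rewrite inE wp orbT.
suff -> : crosses x y a b = (a.2 <= y) (+) (b.2 <= y) by rewrite -addbA addKb.
have bx : b.1 <= x by apply: px; rewrite !inE eqxx orbT.
have {IH px pp} ax : a.1 <= x by apply: px; rewrite !inE eqxx.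
move: nb; rewrite inE negb_or => /andP[nb _].
case: a b ab ax bx na nb => [a1 a2] [b1 b2] /adjP[d].
by rewrite /crosses -!pair_eqE /pair_eq; case: d => /= -[-> ->]; lia.
Qed.

Lemma crossings_succx x y a p :
  path adj a p -> (x, y) \notin a :: p -> crossings x.+1 y a p = crossings x y a p.
Proof.
elim: p a => //= b p IH a /andP[ab pp]; rewrite inE negb_or => /andP[na nb].
rewrite IH //; congr (_ (+) _).
move: nb; rewrite inE negb_or => /andP[nb _].
case: a b ab na nb {IH pp} => [a1 a2] [b1 b2] /adjP[d].
by rewrite /crosses -!pair_eqE /pair_eq; case: d => /= -[-> ->]; lia.
Qed.

(* Horizontal edges of the path in row [y.+1] cannot cross abscissa [x], so the
   crossings of the two rays differ only through the ends of the path. *)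
Lemma crossings_succy x y a p (s := fun w : pt => (w.2 == y.+1) && (w.1 < x)) :
  path adj a p -> (x, y.+1) \notin a :: p ->
  crossings x y.+1 a p = crossings x y a p (+) (s a (+) s (last a p)).
Proof.
elim: p a => [|b p IH] a /=; first by rewrite addbb.
case/andP=> ab pp; rewrite inE negb_or => /andP[na nb]; rewrite IH //.
suff -> : crosses x y.+1 a b = crosses x y a b (+) (s a (+) s b).
  by case: (s a) (s b) (s (last b p)) (crosses _ _ _ _) (crossings _ _ _ _) => -[] [] [] [].
move: nb; rewrite inE negb_or => /andP[nb _].
case: a b ab na nb {IH pp} => [a1 a2] [b1 b2] /adjP[d].
by rewrite /s /crosses -!pair_eqE /pair_eq; case: d => /= -[-> ->]; lia.
Qed.

Definition box (X0 X1 Y0 Y1 : nat) (w : pt) : Prop :=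
  (X0 <= w.1 <= X1) && (Y0 <= w.2 <= Y1).

(* The parity of crossings to the left, corrected by [v.2 < a.2] as if the path
   came from below to its starting point [a] along the left border, is constant
   on connected sets avoiding the path. *)
Lemma noncrossing X0 X1 Y0 Y1 a p (Q : pt -> Prop) l r :
  path adj a p -> (forall w, w \in a :: p -> X0 <= w.1 <= X1) ->
  a.1 = X0 \/ a.2 = Y0 -> (last a p).2 = Y0 \/ Y1 < (last a p).2 ->
  (forall w, Q w -> box X0 X1 Y0 Y1 w /\ w \notin a :: p) ->
  Q (X0, l) -> Q (X1, r) -> conn Q (X0, l) (X1, r) ->
  (l < a.2) = (r < (last a p).2).
Proof.
move=> pp px ha hb Qp Ql Qr lr.
pose inv (v : pt) := crossings v.1 v.2 a p (+) (v.2 < a.2).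
have inv_vert x y : Q (x, y) -> Q (x, y.+1) -> inv (x, y.+1) = inv (x, y).
  move=> /Qp[+ _] /Qp[+ n]; rewrite /inv /box /= => b1 b2.
  (* The starting point changes the parity exactly where the correction changes; the last point, in
     row [Y0] or above [Y1], never changes it. *)
  rewrite (crossings_succy pp n) -addbA; congr (_ (+) _).
  move: n; rewrite inE negb_or -pair_eqE /pair_eq /= => /andP[+ _].
  by have := px a (mem_head _ _); lia.
have inv_hor x y : Q (x, y) -> Q (x.+1, y) -> inv (x.+1, y) = inv (x, y).
  by move=> /Qp[_ n] _; rewrite /inv /= crossings_succx.
have : inv (X1, r) = inv (X0, l).
  apply: (rt_closed (U := fun v => inv v = inv (X0, l))) lr => // -[u1 u2] [v1 v2].
  move=> <- [Qu Qv]; rewrite /adj /= => /orP[] /andP[/eqP ?] /orP[] /eqP ?; subst.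
  - by rewrite -inv_vert.
  - exact: inv_vert.
  - by rewrite -inv_hor.
  - exact: inv_hor.
(* On the left border the ray meets nothing; on the right border the parity compares the heights of
   the two ends of the path. *)
rewrite /inv /= (crossings_left (x := X0)); last by move=> w /px/andP[].
have [rb nr] := Qp _ Qr; rewrite (crossings_right (x := X1)) //; last first.
  by move=> w /px/andP[].
by move: rb; rewrite /box /=; lia.
Qed.

(** The path is prolonged by one vertex above the box, so that its last height exceeds every [r],
    including [Y1]. *)
Lemma noncrossing_top X0 X1 Y0 Y1 (P Q : pt -> Prop) a b l r :
  (forall w, P w -> box X0 X1 Y0 Y1 w) -> (forall w, Q w -> box X0 X1 Y0 Y1 w) ->
  (forall w, P w -> ~ Q w) -> P a -> conn P a b -> Q (X0, l) -> conn Q (X0, l) (X1, r) ->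
  a.1 = X0 \/ a.2 = Y0 -> b.2 = Y1 -> l < a.2.
Proof.
move=> Pb Qb PQ Pa ab Ql lr ha hb.
have [p [pp lp Pp]] := conn_path ab.
have {}Pp w : w \in a :: p -> P w by rewrite inE => /orP[/eqP->|/Pp].
have Pbb : P b by apply: Pp; rewrite -lp mem_last.
have Qr := conn_mem lr Ql.
rewrite (@noncrossing X0 X1 Y0 Y1 a (rcons p (b.1, Y1.+1)) Q l r) //.
- by rewrite last_rcons /=; have := Qb _ Qr; rewrite /box /=; lia.
- by rewrite rcons_path pp lp /adj /= eqxx hb eqxx !orbT.
- move=> w; rewrite -rcons_cons mem_rcons inE => /orP[/eqP->|/Pp/Pb/andP[]//].
  by have /andP[] := Pb _ Pbb.
- by rewrite last_rcons /=; right.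
- move=> w Qw; split; first exact: Qb.
  rewrite -rcons_cons mem_rcons inE; apply/norP; split.
    by apply/eqP => ew; have := Qb w Qw; rewrite ew /box /=; lia.
  by apply/negP => /Pp /PQ.
Qed.

Lemma noncrossing_bottom X0 X1 Y0 Y1 (P Q : pt -> Prop) a b l r :
  (forall w, P w -> box X0 X1 Y0 Y1 w) -> (forall w, Q w -> box X0 X1 Y0 Y1 w) ->
  (forall w, P w -> ~ Q w) -> P a -> conn P a b -> Q (X0, l) -> conn Q (X0, l) (X1, r) ->
  a.1 = X0 -> b.2 = Y0 -> a.2 <= l.
Proof.
move=> Pb Qb PQ Pa ab Ql lr ha hb.
have [p [pp lp Pp]] := conn_path ab.
have {}Pp w : w \in a :: p -> P w by rewrite inE => /orP[/eqP->|/Pp].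
have Qr := conn_mem lr Ql.
rewrite leqNgt (@noncrossing X0 X1 Y0 Y1 a p Q l r) //; try by rewrite lp; left.
- by rewrite lp; have := Qb _ Qr; rewrite /box /=; lia.
- by move=> w /Pp/Pb/andP[].
- by left.
- by move=> w Qw; split; [exact: Qb | apply/negP => /Pp /PQ].
Qed.
(** * Self-similar sets *)

Definition pos (g : nat) (q p : pt) : pt := (q.1 * g + p.1, q.2 * g + p.2).
Definition blk (g : nat) (v : pt) : pt := (v.1 %/ g, v.2 %/ g).
Definition off (g : nat) (v : pt) : pt := (v.1 %% g, v.2 %% g).

Definition in_cell (g : nat) (p : pt) : Prop := (p.1 < g) && (p.2 < g).

(** The union of stages is replaced by the fixed-point equation [ss_X]. All the conditions are
    invariant under exchange of the axes, so horizontal statements yield vertical ones. *)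
Record self_similar (g : nat) (G X : pt -> Prop) : Prop := SelfSimilar {
  ss_gt1 : 1 < g;
  ss_cell : forall p, G p -> in_cell g p;
  ss_col : forall x, x < g -> exists y, G (x, y);
  ss_row : forall y, y < g -> exists x, G (x, y);
  ss_0 : G (0, 0);
  ss_proper : exists2 p, in_cell g p & ~ G p;
  ss_X : forall v, X v <-> X (blk g v) /\ G (off g v);
  ss_X0 : X (0, 0)
}.

(* [bridge g d p p']: when the block of [p'] follows that of [p] in direction
   [d], the copies of [p] and [p'] in these blocks are adjacent. *)
Definition bridge (g : nat) (d : dir) (p p' : pt) : Prop :=
  match d with
  | dL => p = (0, p'.2) /\ p'.1.+1 = g
  | dR => p' = (0, p.2) /\ p.1.+1 = g
  | dB => p = (p'.1, 0) /\ p'.2.+1 = g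
  | dT => p' = (p.1, 0) /\ p.2.+1 = g
  end.

Definition has_nb (X : pt -> Prop) (d : dir) (q : pt) : Prop :=
  exists2 q', step d q q' & X q'.

Definition exits (g : nat) (G : pt -> Prop) (d : dir) (u : pt) : Prop :=
  exists p p', [/\ conn G u p, G p' & bridge g d p p'].

Lemma divmod_succ g a b a' b' : b < g -> b' < g -> a' * g + b' = (a * g + b).+1 ->
  (a' = a /\ b' = b.+1) \/ [/\ a' = a.+1, b' = 0 & b.+1 = g].
Proof.
move=> bg b'g; have [bg1|bg1] := ltnP b.+1 g; rewrite -addnS => e.
  left; have := congr1 (divn^~ g) e; have := congr1 (modn^~ g) e.
  by rewrite !modnMDl !modn_small // !divnMDl ?divn_small ?addn0 //; lia.
have gE : b.+1 = g by apply/eqP; rewrite eqn_leq bg bg1.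
right; move: e; rewrite gE addnC -mulSnr => e.
have := congr1 (divn^~ g) e; have := congr1 (modn^~ g) e; rewrite addnC.
by rewrite !modnMDl modnMl !divnMDl ?mulnK ?divn_small ?modn_small ?addn0 //; lia.
Qed.

Lemma divmod_inj g a b a' b' : b < g -> b' < g -> a' * g + b' = a * g + b ->
  a' = a /\ b' = b.
Proof.
move=> bg b'g e.
have := congr1 (divn^~ g) e; have := congr1 (modn^~ g) e.
by rewrite !modnMDl !modn_small // !divnMDl ?divn_small ?addn0 //; lia.
Qed.

Lemma pos_inj g q p q' p' : in_cell g p -> in_cell g p' ->
  pos g q p = pos g q' p' -> q = q' /\ p = p'.
Proof.
case: q p q' p' => [a b] [c d] [a' b'] [c' d'] /andP[/= h1 h2] /andP[/= h3 h4] [].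
by move=> /divmod_inj[] // -> -> /divmod_inj[] // -> ->.
Qed.

Lemma posK g v : pos g (blk g v) (off g v) = v.
Proof. by case: v => a b; rewrite /pos /= -!divn_eq. Qed.

Lemma off_cell g v : 0 < g -> in_cell g (off g v).
Proof. by move=> g0; rewrite /in_cell /off /= !ltn_mod g0. Qed.

Lemma blk_pos g q p : in_cell g p -> blk g (pos g q p) = q.
Proof.
move=> cp; have g0 : 0 < g by move: cp; rewrite /in_cell; lia.
by have [] := pos_inj (off_cell (pos g q p) g0) cp (posK g (pos g q p)).
Qed.

Lemma off_pos g q p : in_cell g p -> off g (pos g q p) = p.
Proof.
move=> cp; have g0 : 0 < g by move: cp; rewrite /in_cell; lia.
by have [] := pos_inj (off_cell (pos g q p) g0) cp (posK g (pos g q p)).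
Qed.

Lemma step_pos g d q p q' p' : in_cell g p -> in_cell g p' ->
  step d (pos g q p) (pos g q' p') <->
  (q = q' /\ step d p p') \/ (step d q q' /\ bridge g d p p').
Proof.
case: q p q' p' => [a b] [c e] [a' b'] [c' e'] /andP[/= h1 h2] /andP[/= h3 h4].
split.
  case: d => -[] /=.
  - move=> /divmod_succ[] // [] -> -> => [|?] /divmod_inj[] // -> ->; first by left.
    by right.
  - move=> /divmod_succ[] // [] -> -> => [|?] /divmod_inj[] // -> ->; first by left.
    by right.
  - by move=> /divmod_inj[] // -> -> /divmod_succ[] // [] -> -> => [|?]; [left|right].
  - by move=> /divmod_inj[] // -> -> /divmod_succ[] // [] -> -> => [|?]; [left|right].
case=> [[[<- <-]]|[]]; first by case: d => /= -[-> ->]; rewrite /pos /= ?addnS.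
by case: d => /= -[-> ->] [[-> ->] ?]; rewrite /pos /=; congr (_, _); lia.
Qed.

(** * Exchange of the two axes *)

Definition sw (p : pt) : pt := (p.2, p.1).
Definition sw_dir (d : dir) : dir :=
  match d with dL => dB | dB => dL | dR => dT | dT => dR end.

Lemma swK : involutive sw. Proof. by case. Qed.

Lemma sw_dirK : involutive sw_dir. Proof. by case. Qed.

Lemma step_sw d u v : step d u v -> step (sw_dir d) (sw u) (sw v).
Proof. by case: d => /= ->. Qed.

Lemma edge_sw V u v : edge V u v -> edge (V \o sw) (sw u) (sw v).
Proof.
case=> Vu Vv uv; split; rewrite /= ?swK //.
by move: uv => /adjP[d /step_sw/step_adj].
Qed.

Lemma conn_sw V u v : conn V u v -> conn (V \o sw) (sw u) (sw v).
Proof. by apply: rt_mono => a b ab; apply/rt_step/edge_sw. Qed.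

Lemma conn_swE V u v : conn (V \o sw) u v -> conn V (sw u) (sw v).
Proof.
by apply: rt_mono => a b [Va Vb ab]; apply: conn_edge => //;
  have [] := edge_sw (And3 Va Vb ab).
Qed.

Lemma connected_sw V : connected V -> connected (V \o sw).
Proof. by move=> cV u v Vu Vv; rewrite -(swK u) -(swK v); apply/conn_sw/cV. Qed.

Lemma connected_swE V : connected (V \o sw) -> connected V.
Proof.
by move=> cV u v Vu Vv; rewrite -(swK u) -(swK v); apply/conn_swE/cV; rewrite /= swK.
Qed.

Lemma edges_cut_sw V : edges_cut V -> edges_cut (V \o sw).
Proof.
move=> bV u v [Vu Vv uv].
have e : edge V (sw u) (sw v) by split=> //; move: uv => /adjP[d /step_sw/step_adj].
move=> vu; apply: (bV _ _ e); apply: rt_mono vu => a b [[Va Vb ab] n1 n2].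
apply: rt_step; split.
- by split=> //; move: ab => /adjP[d /step_sw/step_adj].
- move=> ab_uv; apply: n1; move/(congr1 (fun z => (sw z.1, sw z.2))): ab_uv.
  by rewrite /= !swK.
- move=> ab_uv; apply: n2; move/(congr1 (fun z => (sw z.1, sw z.2))): ab_uv.
  by rewrite /= !swK.
Qed.

Lemma self_similar_sw g G X : self_similar g G X -> self_similar g (G \o sw) (X \o sw).
Proof.
case=> g1 cell col row G0 [p0 cp0 Gp0] XE X0; split=> //.
- by move=> p /cell; rewrite /in_cell /= andbC.
- by exists (sw p0); rewrite /= ?swK //; rewrite /in_cell andbC.
- by move=> v; apply: XE.
Qed.

Lemma has_nb_sw X d q : has_nb (X \o sw) (sw_dir d) (sw q) -> has_nb X d q.
Proof.
by case=> q' /step_sw; rewrite sw_dirK swK => st Xq; exists (sw q').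
Qed.

Lemma has_nb_swI X d q : has_nb X d q -> has_nb (X \o sw) (sw_dir d) (sw q).
Proof. by case=> q' /step_sw st Xq'; exists (sw q'); rewrite /= ?swK. Qed.

Lemma exits_sw g G d u : exits g G d u -> exits g (G \o sw) (sw_dir d) (sw u).
Proof.
case=> p [p' [up Gp' br]]; exists (sw p), (sw p'); split; first exact: conn_sw.
  by rewrite /= swK.
by case: d br => -[-> <-].
Qed.

(** * Walks between the blocks of a self-similar set *)

Section SelfSimilar.

Variables (g : nat) (G X : pt -> Prop).
Hypothesis ssX : self_similar g G X.

Let g_gt1 : 1 < g. Proof. by case: ssX. Qed.
Let g_gt0 : 0 < g. Proof. exact: ltnW. Qed.
Let cell p : G p -> in_cell g p. Proof. by case: ssX => _ + *; apply. Qed.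

Lemma X_pos q p : in_cell g p -> X (pos g q p) <-> X q /\ G p.
Proof. by move=> cp; rewrite (ss_X ssX) blk_pos // off_pos. Qed.

Lemma X_posI q p : X q -> G p -> X (pos g q p).
Proof. by move=> Xq Gp; apply/X_pos; [exact: cell | split]. Qed.

Lemma X_cases v : X v -> exists q p, [/\ X q, G p & v = pos g q p].
Proof.
by move/(ss_X ssX) => [Xq Gp]; exists (blk g v), (off g v); rewrite posK.
Qed.

Lemma X_cell p : in_cell g p -> X p <-> G p.
Proof.
move=> cp; have := X_pos (0, 0) cp; have := ss_X0 ssX.
rewrite /pos /= !mul0n !add0n -surjective_pairing; tauto.
Qed.

Lemma conn_block (V : pt -> Prop) q p p' : (forall a, G a -> V (pos g q a)) ->
  conn G p p' -> conn V (pos g q p) (pos g q p').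
Proof.
move=> GV; apply: rt_mono => a b [Ga Gb /adjP[d ab]]; apply: conn_edge; auto.
by apply: (@step_adj d); apply/step_pos; [exact: cell | exact: cell | left].
Qed.

Lemma X_step d q p v : X q -> G p -> X v -> step d (pos g q p) v ->
  exists q' p', [/\ v = pos g q' p', X q', G p' &
    (q = q' /\ step d p p') \/ (step d q q' /\ bridge g d p p')].
Proof.
move=> Xq Gp /X_cases[q' [p' [Xq' Gp' ->]]] /step_pos st.
by exists q', p'; split=> //; apply: st; apply: cell.
Qed.

Lemma exits_trans d u v : conn G u v -> exits g G d v -> exits g G d u.
Proof.
by move=> uv [p [p' [vp Gp' br]]]; exists p, p'; split=> //; apply: conn_trans vp.
Qed.

Lemma other_block q : exists2 q', X q' & q' <> q.
Proof.
have [y Gy] := ss_col ssX g_gt1.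
have [->|/eqP ne] := eqVneq q (0, 0); last first.
  by exists (0, 0); [exact: ss_X0 ssX | move/esym].
by exists (1, y) => //; apply/X_cell => //; apply: cell.
Qed.

(** Otherwise the component of [u] inside the block [q] would be closed under the edges of [X],
    while [X] has another block. *)
Lemma exit_block q u : connected X -> X q -> G u ->
  exists2 d, has_nb X d q & exits g G d u.
Proof.
move=> cX Xq Gu; apply: NNPP => noexit.
pose U v := exists2 p, v = pos g q p & conn G u p.
have [q' Xq' q'q] := other_block q.
have [p] : U (pos g q' (0, 0)).
  apply: (rt_closed _ _ (cX (pos g q u) _ (X_posI Xq Gu) _)); last first.
  - by apply: X_posI => //; apply: ss_0 ssX.
  - by exists u => //; apply: conn_refl.
  move=> v w [p -> up] [_ Xw /adjP[d pw]]; have Gp := conn_mem up Gu.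
  have [q1 [p1 [-> Xq1 Gp1]]] := X_step Xq Gp Xw pw.
  case=> [[<- st]|[st br]].
    exists p1 => //; apply: conn_trans up (conn_edge Gp Gp1 _).
    exact: step_adj st.
  by case: noexit; exists d; [exists q1 | exists p, p1].
move=> /pos_inj e up; have [] := e (cell (ss_0 ssX)) (cell (conn_mem up Gu)).
by [].
Qed.

Lemma lacks_L : ~ has_nb X dL (0, 0).
Proof. by case. Qed.

(** Let [(x, y)] be a hole of [G]. If right neighbours always existed, row [y] of [X] would be
    filled from [x1 < g] on, and would contain the copy [(g + x, y)] of the hole. *)
Lemma lacks_R : exists2 q, X q & ~ has_nb X dR q.
Proof.
apply: NNPP => hasR; have [[x y] /andP[/= xg yg] []] := ss_proper ssX.
have [x1 G1] := ss_row ssX yg.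
have X1 k : X (x1 + k, y).
  elim: k => [|k IH]; first by rewrite addn0; apply/X_cell => //; apply: cell.
  have [[q' -> Xq']|no] := classic (has_nb X dR (x1 + k, y)); first by rewrite addnS.
  by case: hasR; exists (x1 + k, y).
have /andP[/= x1g _] := cell G1.
have := X1 (g + x - x1); have -> : x1 + (g + x - x1) = 1 * g + x by lia.
have cxy : in_cell g (x, y) by rewrite /in_cell /= xg yg.
by have := (X_pos (1, 0) cxy).1; rewrite /pos /= mul0n add0n => H /H[].
Qed.

Definition side (d : dir) : nat := if d is (dL | dB) then 0 else g.-1.

(** A point of the column on side [s], copied into the block [q], has no neighbour in direction [s],
    hence has one in direction [t]. So this nonempty column is closed under the cyclic shift in
    direction [t]. *)
Lemma full_col s t q : s = dL \/ s = dR -> t = dB \/ t = dT ->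
  X q -> ~ has_nb X s q -> (forall q, X q -> has_nb X s q \/ has_nb X t q) ->
  forall y, y < g -> G (side s, y).
Proof.
move=> hs ht Xq noS st.
have sg : side s < g by rewrite /side; case: (s); lia.
have [y0 G0] := ss_col ssX sg; have /andP[/= _ y0g] := cell G0.
have next y : G (side s, y) -> exists2 y', G (side s, y') &
    if t is dB then y = y'.+1 \/ y = 0 /\ y'.+1 = g
    else y' = y.+1 \/ y' = 0 /\ y.+1 = g.
  move=> Gy; have [[v sv Xv]|[v tv Xv]] := st _ (X_posI Xq Gy).
    have [q' [[a b] [_ Xq' /cell/andP[/= ag bg] []]]] := X_step Xq Gy Xv sv.
      by case=> _; case: hs => -> /= -[]; lia.
    by case=> ? _; case: noS; exists q'.
  have [q' [[a b] [_ Xq' Gp' br]]] := X_step Xq Gy Xv tv.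
  have /andP[/= ag bg] := cell Gp'; clear Xq' tv st noS.
  exists b; first by case: ht br => -> /= [[_ [ea eb]]|[_ [[ea eb] eg]]];
    [rewrite ea | rewrite ea | rewrite -ea | rewrite -ea].
  by case: ht br => -> /= [[_ [ea eb]]|[_ [[ea eb] eg]]]; [left | right | left | right].
(* From [y0] the shift reaches one end of the column and wraps once to the other end, from which it
   covers every row. *)
suff [down|up] : (forall y y', y < g -> y' <= y -> G (side s, y) -> G (side s, y')) /\
    G (side s, g.-1) \/ (forall y y', y' < g -> y <= y' -> G (side s, y) -> G (side s, y')) /\
    G (side s, 0).
- by move=> y yg; apply: (down.1 g.-1) => //; [lia | lia | exact: down.2].
- by move=> y yg; apply: (up.1 0) => //; exact: up.2.
case: ht next => -> next; [left | right].
  have dn y y' : y < g -> y' <= y -> G (side s, y) -> G (side s, y').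
    elim: y => [|y IH] yg y'y Gy; first by move: y'y; rewrite leqn0 => /eqP->.
    have [->//|ne] := eqVneq y' y.+1.
    have [z Gz [[zy]|[]//]] := next _ Gy; apply: IH; rewrite ?zy //; lia.
  split=> //; have G00 := dn y0 0 y0g (leq0n _) G0.
  have [z Gz [//|[_ zg]]] := next _ G00; by rewrite -zg.
have upw y y' : y' < g -> y <= y' -> G (side s, y) -> G (side s, y').
  elim: y' => [|y' IH] yg y'y Gy; first by move: y'y Gy; rewrite leqn0 => /eqP->.
  have [<-//|ne] := eqVneq y y'.+1.
  have [||z Gz [<-//|[]]] := next y' (IH _ _ Gy); lia.
split=> //; have Gg := upw y0 g.-1 _ _ G0.
have [||z Gz [|[<-//]]] := next g.-1 (Gg _ _); try lia.
by move=> zg; have /andP[] := cell Gz; rewrite /= zg; lia.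
Qed.

(** Without such a link no walk in [X] leaves the blocks of abscissa 0, although column 1 of [G]
    provides a block [(1, y)]. *)
Lemma horizontal_link : connected X ->
  exists z r, [/\ X z, X (z.1.+1, z.2), G (0, r) & G (g.-1, r)].
Proof.
move=> cX; apply: NNPP => no.
have [y Gy] := ss_col ssX g_gt1.
have X1 : X (1, y) by apply/X_cell => //; apply: cell.
have G0 := ss_0 ssX.
suff : (blk g (pos g (1, y) (0, 0))).1 = 0 by rewrite blk_pos //; apply: cell.
apply: (rt_closed (U := fun v => (blk g v).1 = 0) _ _
  (cX (pos g (0, 0) (0, 0)) _ (X_posI (ss_X0 ssX) G0) (X_posI X1 G0))).
  move=> v w v0 [Xv Xw /adjP[d vw]].
  case/X_cases: Xv v0 vw => q [p [Xq Gp ->]] v0 vw.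
  rewrite blk_pos in v0; last exact: cell.
  have [q' [p' [-> Xq' Gp' st]]] := X_step Xq Gp Xw vw.
  rewrite blk_pos; last exact: cell.
  case: st => [[<- //]|[]]; case: q q' Xq Xq' v0 {vw} => [a b] [a' b'] /= Xq Xq' a0.
  case: d => /= -[e1 e2] [pE pg].
  - by rewrite a0 in e1.
  - case: no; exists (a, b), p.2; split=> //.
    + by rewrite -e1 -e2.
    + by rewrite -pE.
    + by rewrite -pg -surjective_pairing.
  - by rewrite -e1.
  - by rewrite e1.
by rewrite blk_pos //; apply: cell.
Qed.

Lemma horizontal_bridge_inj r r' : connected X -> edges_cut X -> connected G ->
  G (0, r) -> G (g.-1, r) -> G (0, r') -> G (g.-1, r') -> r = r'.
Proof.
move=> cX bX cG Gl Gr Gl' Gr'; have [z [_ [Xz Xz' _ _]]] := horizontal_link cX.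
pose B q v := exists2 p, v = pos g q p & G p.
have BX q v : X q -> B q v -> X v by move=> Xq [p -> Gp]; apply: X_posI.
have Bconn q p p' : G p -> G p' -> conn (B q) (pos g q p) (pos g q p').
  by move=> Gp Gp'; apply: conn_block (cG _ _ Gp Gp') => a Ga; exists a.
have link s : G (0, s) -> G (g.-1, s) ->
    adj (pos g z (g.-1, s)) (pos g (z.1.+1, z.2) (0, s)).
  move=> Gs Gs'; apply: (@step_adj dR); apply/step_pos; try exact: cell.
  by right; split=> //=; split=> //; rewrite prednK.
apply: NNPP => ne; apply: (@two_links X (B z) (B (z.1.+1, z.2))
  (pos g z (g.-1, r)) (pos g z (g.-1, r')) (pos g (z.1.+1, z.2) (0, r))
  (pos g (z.1.+1, z.2) (0, r')) bX) => //; auto; try by eexists.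
- by move=> v; apply: BX.
- by move=> v; apply: BX.
- move=> v [p -> Gp] [p' /pos_inj e Gp'].
  by have [] := e (cell Gp) (cell Gp'); case: (z) => a b [] /=; lia.
- by move=> [/eqP]; rewrite eqn_add2l => /eqP/ne.
Qed.

End SelfSimilar.

(** * Exits of the components of a disconnected generator *)

Lemma column_conn (V : pt -> Prop) n c y y' : (forall y, y < n -> V (c, y)) ->
  y < n -> y' < n -> conn V (c, y) (c, y').
Proof.
move=> Vc; suff to0 z : z < n -> conn V (c, z) (c, 0).
  by move=> yn y'n; apply: conn_trans (to0 _ yn) (conn_sym (to0 _ y'n)).
elim: z => [|z IH] zn; first exact: conn_refl.
apply: conn_trans (IH (ltnW zn)); apply: conn_edge; [exact: Vc | exact/Vc/ltnW|].
exact: (@step_adj dB).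
Qed.

(** Off the full column and the full row, the neighbour in direction [s] or [t] stays in the cell,
    hence in [G], and is closer to the corner. *)
Lemma walk_to_corner g G X s t : self_similar g G X ->
  s = dL \/ s = dR -> t = dB \/ t = dT ->
  (forall y, y < g -> G (side g s, y)) -> (forall x, x < g -> G (x, side g t)) ->
  (forall q, X q -> has_nb X s q \/ has_nb X t q) ->
  forall p, G p -> conn G p (side g s, side g t).
Proof.
move=> ssX hs ht colG rowG st p; have g1 := ss_gt1 ssX.
(* The L1 distance to the corner: two opposite truncated differences add up to an absolute value. *)
pose far (p : pt) := (p.1 - side g s) + (side g s - p.1)
  + ((p.2 - side g t) + (side g t - p.2)).
have sg : side g s < g by rewrite /side; case: (s); lia.
have tg : side g t < g by rewrite /side; case: (t); lia.
have [n] := ubnP (far p); elim: n p => // n IH [x y] fp Gp.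
have /andP[/= xg yg] := ss_cell ssX Gp.
have [xs|xs] := eqVneq x (side g s); first by rewrite xs; apply: column_conn colG _ _.
have [yt|yt] := eqVneq y (side g t).
  rewrite yt; apply: (@conn_swE G (side g t, x) (side g t, side g s)).
  exact: column_conn rowG _ _.
have [d [q' st' Xq'] df] : exists2 d, has_nb X d (x, y) &
    forall q', step d (x, y) q' -> far q' < far (x, y) /\ in_cell g q'.
  have [nb|nb] := st _ ((X_cell ssX (ss_cell ssX Gp)).2 Gp).
    exists s => // -[a b]; rewrite /far /in_cell /= ; clear -hs xs xg yg g1.
    by case: hs xs => -> /= xs -[]; lia.
  exists t => // -[a b]; rewrite /far /in_cell /= ; clear -ht yt xg yg g1.
  by case: ht yt => -> /= xs -[]; lia.
have {df}[far_q cq'] := df _ st'.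
have Gq' : G q' by apply/(X_cell ssX).
apply: conn_trans (IH q' _ Gq'); last by lia.
by apply: conn_edge => //; apply: step_adj st'.
Qed.

Lemma some_lacks_both g G X s t : self_similar g G X -> ~ connected G ->
  s = dL \/ s = dR -> t = dB \/ t = dT ->
  exists q, [/\ X q, ~ has_nb X s q & ~ has_nb X t q].
Proof.
move=> ssX ncG hs ht; apply: NNPP => no; apply: ncG.
have ssX' := self_similar_sw ssX.
have st q : X q -> has_nb X s q \/ has_nb X t q.
  move=> Xq; apply: NNPP => /not_or_and[ns nt]; apply: no; by exists q.
have [qs Xqs nqs] : exists2 q, X q & ~ has_nb X s q.
  case: hs => ->; last exact: lacks_R ssX.
  by exists (0, 0); [exact: ss_X0 ssX | exact: lacks_L].
have [qt Xqt nqt] : exists2 q, X q & ~ has_nb X t q.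
  case: ht => ->; last first.
    have [q Xq nq] := lacks_R ssX'; exists (sw q) => // nb; apply: nq.
    by rewrite -(swK q); apply: (@has_nb_swI _ dT).
  by exists (0, 0); [exact: ss_X0 ssX | case].
have colG := full_col ssX hs ht Xqs nqs st.
(* The row is a column of the transposed set, where [s] and [t] exchange their roles. *)
have rowG x : x < g -> G (x, side g t).
  move=> xg; have := @full_col _ _ _ ssX' (sw_dir t) (sw_dir s) (sw qt).
  have -> : side g (sw_dir t) = side g t by case: (t).
  apply=> //; try by [case: ht => ->; tauto | case: hs => ->; tauto].
  - by rewrite /= swK.
  - move=> nb; apply: nqt; apply: (@has_nb_sw _ t); exact: nb.
  - move=> q /= Xq.
    by rewrite -(swK q); case: (st _ Xq) => /has_nb_swI; [right | left].
move=> u v Gu Gv; have toc := walk_to_corner ssX hs ht colG rowG st.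
exact: conn_trans (toc u Gu) (conn_sym (toc v Gv)).
Qed.

(** A block lacking neighbours on sides [s] and [t] forces an exit through [opp s] or [opp t]. For
    the four choices of [s] and [t] together, a missing left or right exit forces both the bottom
    and the top one. *)
Lemma exits_LR_or_BT g G X u : self_similar g G X -> connected X -> ~ connected G ->
  G u -> exits g G dL u /\ exits g G dR u \/ exits g G dB u /\ exits g G dT u.
Proof.
move=> ssX cX ncG Gu.
have ex s t : s = dL \/ s = dR -> t = dB \/ t = dT ->
    exits g G (opp s) u \/ exits g G (opp t) u.
  move=> hs ht; have [q [Xq ns nt]] := some_lacks_both ssX ncG hs ht.
  have [d nb ex] := exit_block ssX cX Xq Gu.
  by case: hs ht ns nt => -> [] -> ns nt; case: d nb ex => nb ex; tauto.
have := (ex dL dB, ex dL dT, (ex dR dB, ex dR dT)) => /=; tauto.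
Qed.
(** * Maximal runs of blocks *)

Definition lift (g : nat) (G R : pt -> Prop) (v : pt) : Prop :=
  R (blk g v) /\ G (off g v).

Definition run (a b y : nat) (q : pt) : Prop := (q.2 == y) && (a <= q.1 <= b).

Lemma run_conn a b y q q' : run a b y q -> run a b y q' -> conn (run a b y) q q'.
Proof.
suff to_end k x : x + k = b -> a <= x -> conn (run a b y) (x, y) (b, y).
  case: q q' => [x z] [x' z'] /andP[/= /eqP-> /andP[ax xb]] /andP[/= /eqP-> /andP[ax' xb']].
  apply: conn_trans (to_end (b - x) x _ _) (conn_sym (to_end (b - x') x' _ _)) => //; lia.
elim: k x => [|k IH] x xkb ax; first by rewrite -xkb addn0; apply: conn_refl.
have tail : conn (run a b y) (x.+1, y) (b, y) by apply: IH; lia.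
apply: conn_trans tail; apply: conn_edge; rewrite /run /=; try lia.
exact: (@step_adj dR).
Qed.

(** Allows a component to serve as the vertex set [P] or [Q] of the noncrossing lemmas. *)
Lemma component_conn V u v w : V u -> conn V u v -> conn V u w ->
  conn (conn V u) v w.
Proof.
move=> Vu uv uw; suff to z : conn V u z -> conn (conn V u) u z.
  exact: conn_trans (conn_sym (to _ uv)) (to _ uw).
move=> uz; elim/clos_refl_trans_ind_left: z / uz => [|z z' uz IH zz']; first exact: conn_refl.
apply: conn_trans IH (conn_edge uz _ _); last by case: zz'.
exact: conn_trans uz (rt_step _ _ _ _ zz').
Qed.

Section Run.

Variables (g : nat) (G X : pt -> Prop).
Hypotheses (ssX : self_similar g G X) (cX : connected X) (bX : edges_cut X).
Hypothesis LR : forall u, G u -> exits g G dL u /\ exits g G dR u.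

Let g_gt1 : 1 < g := ss_gt1 ssX.
Let cell p (Gp : G p) : in_cell g p := ss_cell ssX Gp.

Lemma lift_pos R q p : G p -> lift g G R (pos g q p) <-> R q.
Proof. by move=> Gp; rewrite /lift blk_pos ?off_pos; tauto || exact: cell. Qed.

Lemma liftP R v : lift g G R v -> exists q p, [/\ R q, G p & v = pos g q p].
Proof. by case=> Rq Gp; exists (blk g v), (off g v); rewrite posK. Qed.

Lemma lift_block (R : pt -> Prop) q p p' : R q ->
  conn G p p' -> conn (lift g G R) (pos g q p) (pos g q p').
Proof. by move=> Rq; apply: (conn_block ssX) => a Ga; apply/lift_pos. Qed.

Lemma lift_step (R : pt -> Prop) d q q' p p' : R q -> R q' -> G p -> G p' ->
  step d q q' -> bridge g d p p' -> conn (lift g G R) (pos g q p) (pos g q' p').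
Proof.
move=> Rq Rq' Gp Gp' st br; apply: conn_edge; try exact/lift_pos.
by apply: (@step_adj d); apply/step_pos; [exact: cell | exact: cell | right].
Qed.

Section MaximalRun.

Variables (a b y : nat).
Hypotheses (runX : forall q, run a b y q -> X q).
Hypotheses (maxL : ~ has_nb X dL (a, y)) (maxR : ~ has_nb X dR (b, y)).

Let L := lift g G (run a b y).

Definition on_border (d : dir) (v : pt) : Prop :=
  v.2 = if d is dT then y * g + g.-1 else y * g.

Lemma run_box v : L v -> box (a * g) (b * g + g.-1) (y * g) (y * g + g.-1) v.
Proof.
case/liftP=> -[x z] [p [/andP[/= /eqP-> /andP[ax xb]] /cell/andP[p1 p2] ->]].
rewrite /box /=; have := leq_mul2r g a x; have := leq_mul2r g x b.
by rewrite ax xb !orbT; lia.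
Qed.

(** By [LR] the component of a point within its block leaves it to the right; block after block this
    reaches the last column of the run. *)
Lemma run_right v : L v -> exists r, L (b * g + g.-1, r) /\ conn L v (b * g + g.-1, r).
Proof.
case/liftP=> -[x z] [p [/andP[/= /eqP-> /andP[ax xb]] Gp ->]].
have [k xk] : exists k, x + k = b by exists (b - x); lia.
elim: k x xk ax {xb} p Gp => [|k IH] x xk ax p Gp.
  have {}xk : x = b by lia.
  have [_ [p1 [p2 [pp1 Gp2 [_ p1g]]]]] := LR Gp; exists (y * g + p1.2).
  have -> : (b * g + g.-1, y * g + p1.2) = pos g (x, y) p1.
    by rewrite /pos /= xk; congr (_, _); lia.
  have Rq : run a b y (x, y) by rewrite /run /=; lia.
  split; last exact: lift_block.
  by apply/lift_pos => //; apply: conn_mem pp1 Gp.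
have [_ [p1 [p2 [pp1 Gp2 br]]]] := LR Gp.
have Rq : run a b y (x, y) by rewrite /run /=; lia.
have Rq' : run a b y (x.+1, y) by rewrite /run /=; lia.
have [||r [Lr pr]] := IH x.+1 _ _ p2 Gp2; try lia.
exists r; split=> //; apply: conn_trans (lift_block Rq pp1) _.
by apply: conn_trans pr; apply: (@lift_step _ dR) => //; apply: conn_mem pp1 Gp.
Qed.

Lemma run_left v : L v -> exists r, L (a * g, r) /\ conn L v (a * g, r).
Proof.
case/liftP=> -[x z] [p [/andP[/= /eqP-> /andP[ax xb]] Gp ->]].
have [k xk] : exists k, x = a + k by exists (x - a); lia.
elim: k x xk xb {ax} p Gp => [|k IH] x xk xb p Gp.
  have {}xk : x = a by lia.
  have [[p1 [p2 [pp1 Gp2 [p1E p1g]]]] _] := LR Gp; exists (y * g + p1.2).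
  have -> : (a * g, y * g + p1.2) = pos g (x, y) p1.
    by rewrite /pos xk p1E /=; congr (_, _); lia.
  have Rq : run a b y (x, y) by rewrite /run /=; lia.
  split; last exact: lift_block.
  by apply/lift_pos => //; apply: conn_mem pp1 Gp.
have [[p1 [p2 [pp1 Gp2 br]]] _] := LR Gp.
have Rq : run a b y (x, y) by rewrite /run /=; lia.
have Rq' : run a b y (x.-1, y) by rewrite /run /=; lia.
have [||r [Lr pr]] := IH x.-1 _ _ p2 Gp2; try lia.
exists r; split=> //; apply: conn_trans (lift_block Rq pp1) _.
apply: conn_trans pr; apply: (@lift_step _ dL) => //; first exact: conn_mem pp1 Gp.
by rewrite /= prednK //; lia.
Qed.

(* Two components meeting the same horizontal border would have to cross, since
   each of them joins the left end of the run to its right end. *)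
Lemma border_conn d u v : d = dB \/ d = dT -> L u -> L v ->
  on_border d u -> on_border d v -> conn L u v.
Proof.
move=> hd Lu Lv du dv; apply: NNPP => nuv.
have dis w : conn L u w -> ~ conn L v w.
  by move=> uw vw; apply: nuv; apply: conn_trans uw (conn_sym vw).
have dis' w : conn L v w -> ~ conn L u w by move=> vw /dis.
have bu w : conn L u w -> box (a * g) (b * g + g.-1) (y * g) (y * g + g.-1) w.
  by move=> /conn_mem/(_ Lu)/run_box.
have bv w : conn L v w -> box (a * g) (b * g + g.-1) (y * g) (y * g + g.-1) w.
  by move=> /conn_mem/(_ Lv)/run_box.
have [lu [_ ulu]] := run_left Lu; have [ru [_ uru]] := run_right Lu.
have [lv [_ vlv]] := run_left Lv; have [rv [_ vrv]] := run_right Lv.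
have cu := component_conn Lu ulu uru; have cv := component_conn Lv vlv vrv.
have bou := component_conn Lu ulu (conn_refl L u).
have bov := component_conn Lv vlv (conn_refl L v).
case: hd du dv => -> /= du dv.
  (* At the bottom, each component would start no higher than the other on the left border, hence at
     the same point; at the top, each would start strictly below the other. *)
  have := noncrossing_bottom bu bv dis ulu bou vlv cv erefl du.
  have := noncrossing_bottom bv bu dis' vlv bov ulu cu erefl dv.
  move=> /= le1 le2; apply: nuv; apply: conn_trans ulu (conn_sym _).
  by have -> : lu = lv by lia.
have := noncrossing_top bu bv dis ulu bou vlv cv (or_introl erefl) du.
have := noncrossing_top bv bu dis' vlv bov ulu cu (or_introl erefl) dv.
by move=> /=; lia.
Qed.

Let out q := X q /\ ~ run a b y q.

(** The blocks that hang from side [d] of the run, reached without entering it again. *)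
Definition branch (d : dir) (q : pt) : Prop := exists z z',
  [/\ run a b y z, step d z z', out z' & conn out z' q].

Lemma out_step d z q : run a b y z -> step d z q -> out q -> d = dB \/ d = dT.
Proof.
case: z q => [x z] [x' z'] /andP[/= /eqP-> /andP[ax xb]] st [Xq nrun].
case: d st => /= -[]; try by tauto.
  move=> xE yE; subst; have [ax'|ax'] := ltnP x' a; last first.
    by case: nrun; rewrite /run /= eqxx; lia.
  by case: maxL; exists (x', z') => //=; congr (_, _); lia.
move=> xE yE; subst; have [ax'|ax'] := ltnP b x.+1; last first.
  by case: nrun; rewrite /run /= eqxx; lia.
by case: maxR; exists (x.+1, y) => //=; congr (_, _); lia.
Qed.

(* A branch meeting the run both from above and from below would close a cycle. *)
Lemma branch_step d e z q : branch d q -> run a b y z -> step e z q -> d = e.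
Proof.
move=> [z0 [z1 [rz0 st0 oz1 cq]]] rz st; have oq := conn_mem cq oz1.
have hd := out_step rz0 st0 oz1; have he := out_step rz st oq.
have go : step d z0 z1 -> step e z q -> (z0, z1) <> (z, q) -> d = e.
  move=> _ _ ne; case: (@two_links X (run a b y) out z0 z z1 q) => //.
  - by move=> v [].
  - by move=> v rv [].
  - exact: run_conn.
  - exact: step_adj st0.
  - exact: step_adj st.
case: (classic ((z0, z1) = (z, q))) => [[ez eq']|/(go st0 st)//].
subst z0 z1; move: st0 st; clear; case: z q => [x1 y1] [x2 y2].
by case: d; case: e => //= -[? ?] [? ?]; lia.
Qed.

Lemma maximal_run_connected : connected L.
Proof.
move=> u v Lu Lv.
have LX w : L w -> X w by move=> /liftP[q [p [/runX Xq Gp ->]]]; apply: X_posI ssX _ _ _ _.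
(* Invariant of a walk in [X] from [u]: it is joined to [u] inside [L], or it is in a branch on a
   side [d] which the component of [u] touches. A branch returns to the run through the same side,
   where [border_conn] applies. *)
pose U w := conn L u w \/ exists d t,
  [/\ d = dB \/ d = dT, conn L u t, on_border d t & branch d (blk g w)].
have : U v.
  apply: (rt_closed _ _ (cX (LX _ Lu) (LX _ Lv))); last by left; apply: conn_refl.
  move=> w w' [uw|[d [t [hd ut td bw]]]] [Xw Xw' /adjP[e ww']].
    have Lw := conn_mem uw Lu.
    have [q [p [rq Gp wE]]] := liftP Lw; rewrite wE in ww'.
    have [q' [p' [w'E Xq' Gp' st]]] := X_step ssX (runX rq) Gp Xw' ww'.
    have [rq'|nrq'] := classic (run a b y q').
      left; apply: conn_trans uw (conn_edge Lw _ _).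
        by rewrite w'E; apply/lift_pos.
      by rewrite wE; apply: step_adj ww'.
    case: st => [[qq' _]|[st br]]; first by rewrite qq' in rq.
    have oq' : out q' by [].
    have he := out_step rq st oq'.
    right; exists e, w; split=> //.
      move: rq => /andP[/eqP qy _]; rewrite wE /on_border /= qy.
      by case: he br => -> /= [pE pg]; rewrite ?pE /=; lia.
    rewrite w'E blk_pos; last exact: cell.
    by exists q, q'; split=> //; apply: conn_refl.
  have [q [p [Xq Gp wE]]] := X_cases ssX Xw.
  have cp := cell Gp; rewrite wE blk_pos // in bw; rewrite wE in ww'.
  have [q' [p' [w'E Xq' Gp' st]]] := X_step ssX Xq Gp Xw' ww'.
  have oq : out q by case: bw => z [z' [_ _ oz' /conn_mem]]; apply.
  case: st => [[qq' st]|[st br]].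
    right; exists d, t; split=> //; rewrite w'E blk_pos -?qq' //; exact: cell.
  have [rq'|nrq'] := classic (run a b y q'); last first.
    right; exists d, t; split=> //; rewrite w'E blk_pos; last exact: cell.
    have [z [z' [rz sz oz' zq]]] := bw; exists z, z'; split=> //.
    by apply: conn_trans zq (conn_edge oq _ _); [split | apply: step_adj st].
  left; have dE := branch_step bw rq' (step_opp st).
  have Lw' : L w' by rewrite w'E; apply/lift_pos.
  apply: conn_trans ut (border_conn hd (conn_mem ut Lu) Lw' td _).
  move: rq' => /andP[/eqP qy _]; rewrite w'E /on_border /= qy.
  by case: hd dE br => ->; case: (e) => //= _ [pE pg]; rewrite ?pE /=; lia.
case=> // -[d [t [_ _ _ [z [z' [_ _ oz' /conn_mem/(_ oz')[_]]]]]]].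
by case: Lv.
Qed.

End MaximalRun.

Lemma maximal_run x y r : X (x, y) -> x < r -> ~ X (r, y) ->
  exists a b, [/\ a <= x, x <= b < r, forall q, run a b y q -> X q,
    ~ has_nb X dL (a, y) & ~ has_nb X dR (b, y)].
Proof.
move=> Xx xr nXr.
have [b [xb Xb nb]] : exists b, [/\ x <= b < r,
    forall z, x <= z <= b -> X (z, y) & ~ has_nb X dR (b, y)].
  have [k kE] : exists k, x + k.+1 = r by exists (r - x.+1); lia.
  elim: k x Xx kE {xr} => [|k IH] x Xx kE.
    exists x; split; first by lia.
      by move=> z xz; have -> : z = x by lia.
    by case=> _ /= -> Xx1; apply: nXr; rewrite -kE addn1.
  have [Xx1|nXx1] := classic (X (x.+1, y)); last first.
    exists x; split; first by lia.
      by move=> z xz; have -> : z = x by lia.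
    by case=> _ /= ->.
  have [|b [xb Xb nb]] := IH _ Xx1; first by lia.
  exists b; split=> //; first by lia.
  by move=> z; rewrite leq_eqVlt => /andP[/orP[/eqP<-//|xz zb]]; apply: Xb; rewrite xz.
have [a [ax Xa na]] : exists a, [/\ a <= x,
    forall z, a <= z <= x -> X (z, y) & ~ has_nb X dL (a, y)].
  elim: x Xx {xr xb Xb} => [|x IH] Xx.
    exists 0; split=> //; first by move=> z z0; have -> : z = 0 by lia.
    by case.
  have [Xx1|nXx1] := classic (X (x, y)); last first.
    exists x.+1; split=> //; first by move=> z xz; have -> : z = x.+1 by lia.
    by case=> -[a c] /= [<- <-].
  have [a [ax Xa na]] := IH Xx1; exists a; split=> //; first by lia.
  move=> z /andP[az]; rewrite leq_eqVlt => /orP[/eqP->//|zx].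
  by apply: Xa; rewrite az.
exists a, b; split=> // -[z w] /andP[/= /eqP-> /andP[az zb]].
by have [zx|/ltnW xz] := leqP z x; [apply: Xa | apply: Xb]; rewrite ?az ?xz.
Qed.

(** A strip has [m + 1] blocks, placed anywhere, in [X] or not. *)
Definition strip_connected (m : nat) : Prop :=
  forall a y, connected (lift g G (run a (a + m) y)).

Lemma strip_shift a b y : a <= b -> connected (lift g G (run a b y)) ->
  strip_connected (b - a).
Proof.
move=> ab cL a' y' u v /liftP[q [p [rq Gp ->]]] /liftP[q' [p' [rq' Gp' ->]]].
pose sh (q : pt) : pt := (q.1 - a' + a, y).
have shE z : run a' (a' + (b - a)) y' z -> run a b y (sh z).
  by rewrite /run /sh /= eqxx; lia.
pose f w := pos g (((blk g w).1 - a + a'), y') (off g w).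
have fE z s : G s -> run a' (a' + (b - a)) y' z -> f (pos g (sh z) s) = pos g z s.
  move=> Gs /andP[/eqP zy az]; rewrite /f blk_pos ?off_pos; try exact: cell.
  by congr pos; rewrite /sh; case: (z) zy az => z1 z2 /= -> ?; congr (_, _); lia.
rewrite -(fE q p) // -(fE q' p') //; apply: rt_mono; last first.
  by apply: cL; apply/lift_pos => //; apply: shE.
move=> {q p rq Gp q' p' rq' Gp'} {}u {}v [].
move=> /liftP[q [p [rq Gp ->]]] /liftP[q' [p' [rq' Gp' ->]]] /adjP[d].
have [cp cp'] := (cell Gp, cell Gp').
rewrite /f !blk_pos // !off_pos // step_pos // => st.
have bump z : run a b y z -> run a' (a' + (b - a)) y' (z.1 - a + a', y').
  by rewrite /run /= eqxx; lia.
apply: conn_edge; [exact/lift_pos/bump | exact/lift_pos/bump |].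
apply: (@step_adj d); apply/step_pos => //.
case: st => [[<- st]|[st br]]; [by left | right; split=> //].
case: q q' rq rq' st => [q1 q2] [q1' q2'] /andP[/= /eqP-> r1] /andP[/= /eqP-> r2].
by case: d {br} => -[] /= *; try lia; congr (_, _); lia.
Qed.

Lemma strips_join m m' a y r r' : strip_connected m -> strip_connected m' ->
  (forall q, run a (a + m + m').+1 y q -> X q) -> r <> r' ->
  G (0, r) -> G (g.-1, r) -> G (0, r') -> G (g.-1, r') -> False.
Proof.
move=> cm cm' runX ne Gl Gr Gl' Gr'.
have liftX R v : (forall q, R q -> run a (a + m + m').+1 y q) -> lift g G R v -> X v.
  by move=> sR [/sR/runX Xq Gv]; apply/(ss_X ssX).
have inA : run a (a + m) y (a + m, y) by rewrite /run /=; lia.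
have inB : run (a + m).+1 ((a + m).+1 + m') y ((a + m).+1, y) by rewrite /run /=; lia.
have link s : G (0, s) -> G (g.-1, s) ->
    adj (pos g (a + m, y) (g.-1, s)) (pos g ((a + m).+1, y) (0, s)).
  move=> Gs Gs'; apply: (@step_adj dR); apply/step_pos; try exact: cell.
  by right; split=> //=; split=> //; rewrite prednK //; lia.
apply: (@two_links X (lift g G (run a (a + m) y))
  (lift g G (run (a + m).+1 ((a + m).+1 + m') y))
  (pos g (a + m, y) (g.-1, r)) (pos g (a + m, y) (g.-1, r'))
  (pos g ((a + m).+1, y) (0, r)) (pos g ((a + m).+1, y) (0, r')) bX);
  try exact/lift_pos; auto.
- by move=> v; apply: liftX => q; rewrite /run; lia.
- by move=> v; apply: liftX => q; rewrite /run; lia.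
- by move=> v [+ _] [+ _]; rewrite /run; lia.
- by apply: cm; apply/lift_pos.
- by apply: cm'; apply/lift_pos.
- by move=> [/eqP]; rewrite eqn_add2l => /eqP/ne.
Qed.

Lemma all_LR_connected : connected G.
Proof.
move=> u v Gu Gv; apply: NNPP => nuv.
have [[p1 [q1 [up1 Gq1 [p1E q1g]]]] _] := LR Gu.
have [[p2 [q2 [vp2 Gq2 [p2E q2g]]]] _] := LR Gv.
have Gp1 := conn_mem up1 Gu; have Gp2 := conn_mem vp2 Gv.
set r := q1.2 in p1E; set r' := q2.2 in p2E.
have q1E : q1 = (g.-1, r) by rewrite /r -q1g; case: (q1).
have q2E : q2 = (g.-1, r') by rewrite /r' -q2g; case: (q2).
(* Distinct components have distinct points on the left side, hence distinct bridge rows. *)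
have ne : r <> r'.
  move=> rr; apply: nuv; apply: conn_trans up1 (conn_sym _).
  by rewrite p1E rr -p2E.
rewrite {}p1E {}p2E {}q1E {}q2E in Gp1 Gp2 Gq1 Gq2.
have join m m' a y cm cm' runX :=
  @strips_join m m' a y r r' cm cm' runX ne Gp1 Gq1 Gp2 Gq2.
have [[z1 z2] Xz nz] := lacks_R ssX.
have nXz : ~ X (z1.+1, z2) by move=> Xz'; apply: nz; exists (z1.+1, z2).
have [full|] := classic (forall x, x < g -> G (x, r)).
  have [a [b [az zb runX nL nR]]] := maximal_run Xz (ltnSn z1) nXz.
  have cm := strip_shift _ (maximal_run_connected runX nL nR).
  (* Row [r] being full, the run of [b - a + 1] blocks contains a horizontal segment [g] times as
     long, with room for two strips since [g] is at least 2. *)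
  apply: (@join (b - a) (b - a) (a * g) (z2 * g + r)); try by apply: cm; lia.
  have rg : r < g by have /andP[] := cell Gp1.
  move=> [x y] /andP[/= /eqP-> xr]; apply/(ss_X ssX); split; last first.
    by rewrite /off /= modnMDl (modn_small rg); apply: full; rewrite ltn_mod; lia.
  rewrite /blk /= divnMDl; last by lia.
  rewrite (divn_small rg) addn0; apply: runX; rewrite /run /= eqxx /=.
  have e1 : a <= x %/ g by rewrite leq_divRL; lia.
  have e2 : x %/ g < b.+1 by rewrite ltn_divLR; nia.
  by rewrite e1.
move=> /not_all_ex_not[x0 nx0]; have [x0g nG] := imply_to_and _ _ nx0.
have c0 : in_cell g (x0, r) by rewrite /in_cell /= x0g; have /andP[] := cell Gp1.
(* The final run of row [r] is a maximal run of [X] in the block [(z1, z2)], which has no right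
   neighbour; the hole [x0] keeps its left end inside the block. *)
have XL : X (z1 * g + g.-1, z2 * g + r) by apply: (X_posI ssX Xz Gq1).
have nXR : ~ X ((z1 * g + g.-1).+1, z2 * g + r).
  move=> XR; apply: nXz; have := (X_pos ssX (z1.+1, z2) (cell Gp1)).1.
  rewrite /pos /= addn0 mulSnr; have -> : z1 * g + g = (z1 * g + g.-1).+1 by lia.
  by case.
have [a [b [az zb runA nLA nRA]]] := maximal_run XL (ltnSn _) nXR.
have bE : b = z1 * g + g.-1 by lia.
have aE : z1 * g + x0 < a.
  rewrite ltnNge; apply/negP => ax0; apply: nG.
  suff /(X_pos ssX (z1, z2) c0)[] : X (pos g (z1, z2) (x0, r)) by []; apply: runA.
  by rewrite /run /pos /= eqxx /=; lia.
have cA := strip_shift _ (maximal_run_connected runA nLA nRA).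
(* The initial run of row [r] is a maximal run of [X] in the block [(0, 0)], stopped by [x0]. *)
have X0r : X (0, r) by apply/(X_cell ssX) => //; apply: cell.
have x0_gt0 : 0 < x0 by case: (x0) nG => // /(_ Gp1).
have nX0 : ~ X (x0, r) by move/(X_cell ssX c0).
have [a' [c [a0 c0' runB nLB nRB]]] := maximal_run X0r x0_gt0 nX0.
have {}a0 : a' = 0 by lia.
subst a'; have cB := strip_shift _ (maximal_run_connected runB nLB nRB).
(* In two horizontally adjacent blocks, the final run of the first is followed at once by the
   initial run of the second. *)
have [[w1 w2] [_ [Xw Xw' _ _]]] := horizontal_link ssX cX.
pose al := a - z1 * g.
apply: (@join (b - a) (c - 0) (w1 * g + al) (w2 * g + r)); try by [apply: cA; lia | exact: cB].
have inA x : al <= x < g -> G (x, r).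
  move=> xg; have cx : in_cell g (x, r) by move: c0; rewrite /in_cell /=; lia.
  suff /(X_pos ssX (z1, z2) cx)[] : X (pos g (z1, z2) (x, r)) by []; apply: runA.
  by rewrite /run /pos /= eqxx /=; lia.
have inB x : x <= c -> G (x, r).
  move=> xc; have cx : in_cell g (x, r) by move: c0; rewrite /in_cell /=; lia.
  by apply/(X_cell ssX cx); apply: runB; rewrite /run /= eqxx.
move=> [x y] /andP[/= /eqP-> xr].
have [xw|xw] := ltnP x (w1 * g + g).
  have -> : (x, w2 * g + r) = pos g (w1, w2) (x - w1 * g, r).
    by rewrite /pos /=; congr (_, _); lia.
  by apply: X_posI ssX _ _ Xw (inA _ _); lia.
have -> : (x, w2 * g + r) = pos g (w1.+1, w2) (x - (w1 * g + g), r).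
  by rewrite /pos /=; congr (_, _); lia.
by apply: X_posI ssX _ _ Xw' (inB _ _); lia.
Qed.

End Run.

Lemma generator_connected g G X : self_similar g G X -> connected X -> edges_cut X ->
  connected G.
Proof.
move=> ssX cX bX; apply: NNPP => ncG.
have ex u Gu := @exits_LR_or_BT g G X u ssX cX ncG Gu.
have [allLR|/not_all_ex_not[u nu]] := classic
    (forall u, G u -> exits g G dL u /\ exits g G dR u).
  exact/ncG/(all_LR_connected ssX cX bX allLR).
have [Gu nLR] := imply_to_and _ _ nu.
have [allBT|/not_all_ex_not[v nv]] := classic
    (forall u, G u -> exits g G dB u /\ exits g G dT u).
  apply/ncG/connected_swE.
  apply: (all_LR_connected (self_similar_sw ssX) (connected_sw cX) (edges_cut_sw bX)).
  move=> w Gw; have [exB exT] := allBT _ Gw; rewrite -(swK w).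
  by split; [exact: (exits_sw exB) | exact: (exits_sw exT)].
have [Gv nBT] := imply_to_and _ _ nv.
have [/nLR//|[[b [b' [ub Gb' [bE _]]]] [t [t' [ut _ [_ tg]]]]]] := ex u Gu.
have [[[l [l' [vl Gl' [lE _]]]] [r [r' [vr _ [_ rg]]]]]|/nBT//] := ex v Gv.
have nuv : ~ conn G u v.
  by move=> uv; case: (ex v Gv) => // -[eL eR]; apply: nLR; split;
    apply: exits_trans uv _.
have gE : g.-1.+1 = g by have := ss_gt1 ssX; lia.
have inbox w s : G s -> conn G s w -> box 0 g.-1 0 g.-1 w.
  by move=> Gs /conn_mem/(_ Gs)/(ss_cell ssX)/andP[]; rewrite /box; lia.
have rE : r = (g.-1, r.2) by rewrite -rg; case: (r).
(* The component of [u] joins bottom to top and that of [v] joins left to right. The path from [b],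
   at height 0, would leave [l] strictly below it. *)
have := @noncrossing_top 0 g.-1 0 g.-1 (conn G u) (conn G v) b t l.2 r.2.
rewrite -rE bE /=; have lE' : l = (0, l.2) by rewrite lE.
rewrite -lE' -bE => H; suff : l.2 < 0 by [].
apply: H => //; try by [move=> w; apply: inbox | right | rewrite -tg].
- by move=> w uw vw; apply: nuv; apply: conn_trans uw (conn_sym vw).
- exact: component_conn Gu ub ut.
- exact: component_conn Gv vl vr.
Qed.
(** * Trees from a tree generator *)

Definition one_bridge (g : nat) (G : pt -> Prop) : Prop :=
  (exists r, G (0, r) /\ G (g.-1, r)) /\
  (forall r r', G (0, r) -> G (g.-1, r) -> G (0, r') -> G (g.-1, r') -> r = r').

Lemma bridge_exists g G d : 0 < g -> one_bridge g G -> one_bridge g (G \o sw) ->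
  exists p p', [/\ G p, G p' & bridge g d p p'].
Proof.
move=> g0 [[r [Gr Gr']] _] [[c [Gc Gc']] _].
case: d.
- by exists (0, r), (g.-1, r); split=> //; split=> //; apply: prednK.
- by exists (g.-1, r), (0, r); split=> //; split=> //; apply: prednK.
- by exists (c, 0), (c, g.-1); split=> //; split=> //; apply: prednK.
- by exists (c, g.-1), (c, 0); split=> //; split=> //; apply: prednK.
Qed.

Lemma bridge_unique g G d p p' r r' : one_bridge g G -> one_bridge g (G \o sw) ->
  G p -> G p' -> G r -> G r' -> bridge g d p p' -> bridge g d r r' ->
  p = r /\ p' = r'.
Proof.
move=> [_ uG] [_ uGs].
case: p p' r r' => [a b] [a' b'] [c e] [c' e'] G1 G2 G3 G4.
case: d => /= -[[? ?] ga] [[? ?] gc]; subst; rewrite /= -?ga /= in uG uGs *.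
- have ? : c' = a' by lia.
  by subst c'; rewrite (uG b' e').
- have ? : c = a by lia.
  by subst c; rewrite (uG b e).
- have ? : e' = b' by lia.
  by subst e'; rewrite (uGs a' c').
have ? : e = b by lia.
by subst e; rewrite (uGs a c).
Qed.

Lemma step_inj d d' u v : step d u v -> step d' u v -> d = d'.
Proof.
by case: u v => [a b] [c e]; case: d; case: d' => //= -[? ?] [? ?]; lia.
Qed.

Section Lifting.

Variables (g : nat) (G X : pt -> Prop).
Hypothesis ssX : self_similar g G X.
Hypotheses (hb : one_bridge g G) (vb : one_bridge g (G \o sw)).

Let g_gt1 : 1 < g := ss_gt1 ssX.
Let g_gt0 : 0 < g := ltnW g_gt1.
Let cell p (Gp : G p) : in_cell g p := ss_cell ssX Gp.

Lemma conn_lift q q' p p' : connected G -> X q -> conn X q q' -> G p -> G p' ->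
  conn X (pos g q p) (pos g q' p').
Proof.
move=> cG Xq qq' Gp; have block z s s' : X z -> G s -> G s' ->
    conn X (pos g z s) (pos g z s').
  move=> Xz Gs Gs'; apply: (conn_block ssX) (cG _ _ Gs Gs') => a.
  exact: (X_posI ssX Xz).
elim/clos_refl_trans_ind_left: q' / qq' p' => [|z z' qz IH [Xz Xz' /adjP[d st]]] p' Gp'.
  exact: block.
have [s [s' [Gs Gs' br]]] := bridge_exists d g_gt0 hb vb.
apply: conn_trans (IH s Gs) (conn_trans _ (block _ _ _ Xz' Gs' Gp')).
apply: conn_edge; [exact: (X_posI ssX Xz Gs) | exact: (X_posI ssX Xz' Gs') |].
by apply: (@step_adj d); apply/step_pos; [exact: cell | exact: cell | right].
Qed.

Lemma blk_lt v : 0 < v.1 + v.2 -> (blk g v).1 + (blk g v).2 < v.1 + v.2.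
Proof.
case: v => a b /= ab; have la := leq_div a g; have lb := leq_div b g.
have [a0|a0] := posnP a; last by have := ltn_Pdiv g_gt1 a0; lia.
have b0 : 0 < b by lia.
by have := ltn_Pdiv g_gt1 b0; lia.
Qed.

(** By induction on the coordinate sum, the block of [v] is joined to [(0, 0)] in [X]; this walk
    between blocks lifts to one from [v]. *)
Lemma connected_lift : connected G -> connected X.
Proof.
move=> cG; suff to0 v : X v -> conn X v (0, 0).
  by move=> u v Xu Xv; apply: conn_trans (to0 _ Xu) (conn_sym (to0 _ Xv)).
have [n] := ubnP (v.1 + v.2); elim: n v => // n IH v vn Xv.
have [v0|v0] := posnP (v.1 + v.2).
  have -> : v = (0, 0) by case: v v0 {vn Xv} => a b /= ab; congr (_, _); lia.
  exact: conn_refl.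
have [Xq Gp] := (ss_X ssX v).1 Xv.
rewrite -{1}(posK g v).
apply: (conn_lift cG Xq (IH _ _ Xq) Gp (ss_0 ssX)).
by have := blk_lt v0; lia.
Qed.

Lemma off_adj a b : adj a b -> blk g a = blk g b -> adj (off g a) (off g b).
Proof.
rewrite -{1}(posK g a) -{1}(posK g b) => /adjP[d].
rewrite step_pos; try exact: off_cell.
by move=> [[_ /step_adj//]|[st _]] ab; move: st; rewrite ab; case: d => -[]; lia.
Qed.

Lemma blk_adj a b : adj a b -> blk g a <> blk g b ->
  exists2 d, step d (blk g a) (blk g b) & bridge g d (off g a) (off g b).
Proof.
rewrite -{1}(posK g a) -{1}(posK g b) => /adjP[d].
by rewrite step_pos; [move=> [[//]|[]]; exists d | exact: off_cell..].
Qed.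

(** With one bridge in each direction, an edge between distinct blocks is determined by these
    blocks. *)
Lemma link_unique a b x y : edge X a b -> edge X x y ->
  blk g a = blk g x -> blk g b = blk g y -> blk g x <> blk g y -> (a, b) = (x, y).
Proof.
move=> [Xa Xb ab] [Xx Xy xy] ax by_ ne.
have [d st br] := blk_adj ab (fun e => ne (etrans (esym ax) (etrans e by_))).
have [d' st' br'] := blk_adj xy ne.
rewrite ax by_ in st; have dd' := step_inj st st'; subst d'.
have off_G v : X v -> G (off g v) by move/(ss_X ssX)=> [].
have [ea eb] := bridge_unique hb vb (off_G _ Xa) (off_G _ Xb) (off_G _ Xx) (off_G _ Xy) br br'.
by rewrite -(posK g a) -(posK g b) ax by_ ea eb !posK.
Qed.

Lemma acyclic_lift : grid_acyclic G -> grid_acyclic X.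
Proof.
(* Truncation makes induction possible: for positive [n], the quotient [blk] maps [XN n.+1] into
   [XN n]. *)
move=> acG; pose XN n v := X v /\ v.1 + v.2 < n.
suff acN n : grid_acyclic (XN n).
  move=> [c [sc uc cc Xc]]; apply: (acN (\max_(v <- c) (v.1 + v.2)).+1).
  exists c; split=> // v vc; split; first exact: Xc.
  by rewrite ltnS; apply: leq_bigmax_seq.
elim: n => [|n IH].
  by move=> [[|v c] [sc _ _ Xc]] //; case: (Xc v (mem_head _ _)).
move=> [c [sc uc cc Xc]].
pose e := [rel a b : pt | adj a b && (blk g a == blk g b)].
(* Otherwise the cycle stays in one block and its offsets form a cycle of [G]. *)
have [x [xc nex]] : exists x, x \in c /\ blk g x <> blk g (next c x).
  apply: NNPP => nox; apply: acG; exists (map (off g) c).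
  have {nox} ce : cycle e c.
    apply: cycle_from_next => // x xc; rewrite /= (next_cycle cc xc) /=.
    by apply/eqP; apply: NNPP => ne; apply: nox; exists x.
  have blk_c v : v \in c -> blk g v = blk g (head (0, 0) c).
    case: (c) ce => [//|v0 s] /= ps; rewrite inE => /orP[/eqP->//|vs].
    have tr : ssrbool.transitive [rel a b | blk g a == blk g b].
      by move=> a b d /= /eqP-> /eqP->.
    have /(order_path_min tr)/allP/(_ v) : path [rel a b | blk g a == blk g b] v0 (rcons s v0).
      by apply: sub_path ps => a b /= /andP[].
    by rewrite mem_rcons inE vs orbT => /(_ isT)/= /eqP->.
  split.
  - by rewrite size_map.
  - rewrite map_inj_in_uniq // => a b ac bc ab.
    by rewrite -(posK g a) -(posK g b) (blk_c a) // (blk_c b) // ab.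
  - case: (c) ce => [//|v0 s] /= ps; rewrite -map_rcons path_map.
    by apply: sub_path ps => a b /= /andP[ab /eqP]; apply: off_adj.
  - by move=> w /mapP[v vc ->]; have [/(ss_X ssX)[]] := Xc v vc.
have [[[Xx xn] [Xy yn] xy] yx] := cycle_edge_but sc uc cc Xc xc.
set y := next c x in nex Xy yn xy yx *.
(* Needed for the origin, the only point whose block does not have a smaller coordinate sum. *)
have n_gt0 : 0 < n by move: xy; rewrite /adj; lia.
have blkXN v : XN n.+1 v -> XN n (blk g v).
  move=> [/(ss_X ssX)[Xv _] vn]; split=> //.
  by have [v0|/blk_lt] := posnP (v.1 + v.2); [rewrite /blk; have := leq_div v.1 g;
    have := leq_div v.2 g; rewrite /=; lia | lia].
have quot_edge a b : edge (XN n.+1) a b -> blk g a <> blk g b ->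
    edge (XN n) (blk g a) (blk g b).
  move=> [Xa Xb ab] ne; split; try exact: blkXN.
  by have [d /step_adj] := blk_adj ab ne.
have XNX a b : edge (XN n.+1) a b -> edge X a b by move=> [[? _] [? _] ?].
have exy : edge (XN n.+1) x y by split.
apply: (acyclic_edges_cut IH (quot_edge _ _ exy nex)).
(* The rest of the cycle projects to a bypass: edges inside a block collapse, and by [link_unique]
   only the removed edge lies over its image. *)
apply: rt_mono yx => a b [eab n1 n2].
have [->|/eqP ne] := eqVneq (blk g a) (blk g b); first exact: rt_refl.
apply: rt_step; split; first exact: quot_edge.
- by move=> /pair_equal_spec[ax bx]; apply: n1; apply: link_unique => //; exact: XNX.
- move=> /pair_equal_spec[ax bx]; apply: n2.
  by have [-> ->] := link_unique (edge_sym (XNX _ _ eab)) (XNX _ _ exy) bx ax nex.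
Qed.

End Lifting.

Lemma tree_one_bridge g G X : self_similar g G X -> connected X -> edges_cut X ->
  connected G -> one_bridge g G.
Proof.
move=> ssX cX bX cG; split; last first.
  by move=> r r'; apply: (horizontal_bridge_inj ssX cX bX cG).
by have [z [r [_ _ Gr Gr']]] := horizontal_link ssX cX; exists r.
Qed.

Lemma self_similar_tree g G X : self_similar g G X ->
  grid_tree X <-> [/\ grid_tree G, one_bridge g G & one_bridge g (G \o sw)].
Proof.
move=> ssX; split=> [[/grid_connectedP cX acX]|[[/grid_connectedP cG acG] hb vb]].
  have bX := acyclic_edges_cut acX; have cG := generator_connected ssX cX bX.
  split; first split.
  - exact/grid_connectedP.
  - move=> [c [sc uc cc Gc]]; apply: acX; exists c; split=> // v /Gc Gv.
    by apply/(X_cell ssX) => //; apply: ss_cell ssX _ Gv.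
  - exact: tree_one_bridge ssX cX bX cG.
  - exact: tree_one_bridge (self_similar_sw ssX) (connected_sw cX)
      (edges_cut_sw bX) (connected_sw cG).
split; first exact/grid_connectedP/(connected_lift ssX hb vb cG).
exact: acyclic_lift ssX hb vb acG.
Qed.
(** * The discrete fractal *)

Section Generator.

Variables (g : nat) (G : {set 'I_g * 'I_g}).
Hypotheses (g_gt1 : 1 < g) (genG : generator G).

Lemma setN2_cell p : setN2 G p -> in_cell g p.
Proof. by case=> -[x y] _ <-; rewrite /in_cell /= !ltn_ord. Qed.

Lemma setN2_emb p : setN2 G (emb p) <-> p \in G.
Proof.
split=> [[[x y] xyG [/val_inj xp /val_inj yp]]|pG]; last by exists p.
by case: p xp yp => a b /= <- <-.
Qed.

(** The definition adds a most significant digit in base [g], whereas self-similarity splits off the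
    least significant one; the induction exchanges the two. *)
Lemma Xs_succ i v : Xs G i.+1 v <-> Xs G i (blk g v) /\ setN2 G (off g v).
Proof.
have g_gt0 : 0 < g := ltnW g_gt1.
have blk_add m n k : blk g (m.1 + g ^ k.+1 * n.1, m.2 + g ^ k.+1 * n.2) =
    ((blk g m).1 + g ^ k * n.1, (blk g m).2 + g ^ k * n.2).
  rewrite /blk /= !expnS -!mulnA ![g * _]mulnC.
  by rewrite ![_ + _ * g]addnC !divnMDl // ![_ * _ + _]addnC.
have off_add m n k : off g (m.1 + g ^ k.+1 * n.1, m.2 + g ^ k.+1 * n.2) = off g m.
  by rewrite /off /= !expnS -!mulnA ![g * _]mulnC ![_ + _ * g]addnC !modnMDl.
elim: i v => [|i IH] v.
  split=> [[m [n [Gm Gn ->]]]|[Gq Gp]].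
    rewrite blk_add off_add; have cm := setN2_cell Gm.
    have mE : pos g (0, 0) m = m by rewrite /pos /= !mul0n !add0n -surjective_pairing.
    have -> : off g m = m by rewrite -{1}mE off_pos.
    have -> : blk g m = (0, 0) by rewrite -mE blk_pos.
    by rewrite !expn0 !mul1n !add0n -surjective_pairing.
  exists (off g v), (blk g v); split=> //.
  by rewrite -{1}(posK g v) /pos expn1; congr (_, _); lia.
split=> [[m [n [/IH[Xm Gm] Gn ->]]]|[[m [n [Xm Gn blkE]]] Go]].
  by rewrite blk_add off_add; split=> //; exists (blk g m), n.
exists (pos g m (off g v)), n; split=> //.
  by apply/IH; rewrite blk_pos ?off_pos //; exact: setN2_cell.
rewrite -{1}(posK g v) blkE /pos /= !mulnDl; congr (_, _);
  by rewrite [g ^ i.+2]expnS; lia.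
Qed.

Lemma fractal_self_similar : self_similar g (setN2 G) (fractal G).
Proof.
case: genG => G0 _ nT row col; split=> //.
- exact: setN2_cell.
- by move=> x xg; have [y xy] := col (Ordinal xg); exists (val y); exists (Ordinal xg, y).
- by move=> y yg; have [x xy] := row (Ordinal yg); exists (val x); exists (x, Ordinal yg).
- have /subsetPn[p _ nGp] : ~~ (setT \subset G) by rewrite subTset.
  by exists (emb p); [rewrite /in_cell /= !ltn_ord | rewrite setN2_emb; apply/negP].
- move=> v; split=> [[[|i] Xv]|[[i Xq] Gp]].
  + have cv := setN2_cell Xv; have := blk_pos (0, 0) cv; have := off_pos (0, 0) cv.
    rewrite /pos /= !mul0n !add0n -surjective_pairing => -> ->.
    by split=> //; exists 0.
  + by have [Xq Gp] := (Xs_succ i v).1 Xv; split=> //; exists i.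
  + by exists i.+1; apply/Xs_succ.
- by exists 0.
Qed.

Lemma bigmin_eq0 (F : 'I_g * 'I_g -> nat) p : p \in G -> F p = 0 ->
  \big[minn/g]_(q in G) F q = 0.
Proof.
move=> pG Fp; apply/eqP; rewrite -leqn0 -Fp.
have : p \in index_enum ('I_g * 'I_g)%type by rewrite mem_index_enum.
elim: (index_enum _) => // q s IH; rewrite inE big_cons => /orP[/eqP <-|/IH ps].
  by rewrite pG geq_minl.
by case: ifP => // _; apply: leq_trans (geq_minr _ _) ps.
Qed.

Lemma bigmax_eq (F : 'I_g * 'I_g -> nat) p : p \in G -> F p = g.-1 ->
  (forall q, F q < g) -> \max_(q in G) F q = g.-1.
Proof.
move=> pG Fp Fg; apply/eqP; rewrite eqn_leq; apply/andP; split.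
  by apply/bigmax_leqP => q _; have := Fg q; lia.
by rewrite -Fp; apply: leq_bigmax_cond.
Qed.

Lemma extrema : [/\ lS G = 0, rS G = g.-1, bS G = 0 & tS G = g.-1].
Proof.
have ssF := fractal_self_similar; have gp : g.-1 < g by lia.
have [p pG [px py]] := ss_0 ssF.
have [y [q qG [qx _]]] := ss_col ssF gp; have [x [r rG [_ ry]]] := ss_row ssF gp.
split.
- exact: bigmin_eq0 pG px.
- by apply: bigmax_eq qG qx _ => s; apply: ltn_ord.
- exact: bigmin_eq0 pG py.
- by apply: bigmax_eq rG ry _ => s; apply: ltn_ord.
Qed.

Lemma card_eq1 (P : nat -> Prop) (A : {set 'I_g}) :
  (forall y : 'I_g, y \in A <-> P y) -> (forall y, P y -> y < g) ->
  #|A| = 1 <-> (exists y, P y) /\ (forall y y', P y -> P y' -> y = y').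
Proof.
move=> AP Pg; split=> [/eqP/cards1P[y0 AE]|[[y Py] inj]].
  have P0 y : P y -> y = y0.
    by move=> Py; have /AP := Py : P (Ordinal (Pg y Py)); rewrite AE inE => /eqP <-.
  split; first by exists y0; apply/AP; rewrite AE inE.
  by move=> y y' /P0-> /P0.
apply/eqP/cards1P; exists (Ordinal (Pg y Py)); apply/setP => z; rewrite inE.
apply/idP/eqP => [/AP Pz|->]; last exact/AP.
exact/val_inj/inj.
Qed.

Lemma nhb_eq1 : nhb G = 1 <-> one_bridge g (setN2 G).
Proof.
have [lE rE _ _] := extrema.
rewrite /nhb (@card_eq1 (fun y => setN2 G (0, y) /\ setN2 G (g.-1, y)));
  [|move=> y|by move=> y [/setN2_cell/andP[]]].
  rewrite /one_bridge; split=> -[ex inj]; split=> // r r'.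
    by move=> *; apply: inj.
  by move=> [? ?] [? ?]; apply: inj.
rewrite inE lE rE; split=> [/andP[/exists_inP[p pG /andP[/eqP px /eqP py]]]|].
  move=> /exists_inP[q qG /andP[/eqP qx /eqP qy]].
  by split; [exists p => // | exists q => //]; rewrite /emb ?px ?qx ?py ?qy.
move=> [[p pG [px py]] [q qG [qx qy]]]; apply/andP; split; apply/exists_inP.
  by exists p => //; apply/andP; split; apply/eqP; [exact: px | exact: val_inj].
by exists q => //; apply/andP; split; apply/eqP; [exact: qx | exact: val_inj].
Qed.

Lemma nvb_eq1 : nvb G = 1 <-> one_bridge g (setN2 G \o sw).
Proof.
have [_ _ bE tE] := extrema.
rewrite /nvb (@card_eq1 (fun x => setN2 G (x, 0) /\ setN2 G (x, g.-1)));
  [|move=> x|by move=> x [/setN2_cell/andP[]]].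
  rewrite /one_bridge; split=> -[ex inj]; split=> // r r'.
    by move=> *; apply: inj.
  by move=> [? ?] [? ?]; apply: inj.
rewrite inE bE tE; split=> [/andP[/exists_inP[p pG /andP[/eqP px /eqP py]]]|].
  move=> /exists_inP[q qG /andP[/eqP qx /eqP qy]].
  by split; [exists p => // | exists q => //]; rewrite /emb ?px ?qx ?py ?qy.
move=> [[p pG [px py]] [q qG [qx qy]]]; apply/andP; split; apply/exists_inP.
  by exists p => //; apply/andP; split; apply/eqP; [exact: val_inj | exact: py].
by exists q => //; apply/andP; split; apply/eqP; [exact: val_inj | exact: qy].
Qed.

End Generator.

Theorem theorem2p1 (g : nat) (G : {set 'I_g * 'I_g}) :
  1 < g -> generator G ->
  (grid_tree (fractal G) <->
   (grid_tree (setN2 G) /\ nhb G = 1 /\ nvb G = 1)).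
Proof.
move=> g1 genG; rewrite (self_similar_tree (fractal_self_similar g1 genG)).
have := nhb_eq1 g1 genG; have := nvb_eq1 g1 genG.
by split=> [[? ? ?]|[? [? ?]]]; [split=> //; split | split=> //]; tauto.
Qed.
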